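(* There exists an absolute constant $M>0$ such that for every $F\in\mathcal{F}^2(\mathbb{C})$ we have \[ \inf_{\lambda\in\mathbb{C},\,|\lambda|=1}\lVert F-\lambda\rVert_{\mathcal{F}}\;\le\; M\,\bigl\|\,\lvert F\rvert-1\,\bigr\|_{\mathcal{F}}, \] where $\lambda$ and $1$ denote constant functions.
   Context: For any measurable function $F:\mathbb{C}\to\mathbb{C}$ (not necessarily holomorphic), the Fock norm is defined by \[ \lVert F\rVert_{\mathcal{F}}^2:=\frac{1}{\pi}\int_{\mathbb{C}}|F(z)|^2 e^{-|z|^2}\,dm(z), \] with $m$ the Lebesgue measure on $\mathbb{C}\cong\mathbb{R}^2$. The Bargmann--Fock space $\mathcal{F}^2(\mathbb{C})$ is the space of entire functions $F$ with $\lVert F\rVert_{\mathcal{F}}<\infty$. *)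

(* Defs.v *)
From HB Require Import structures.
From mathcomp Require Import all_boot all_order all_algebra.
From mathcomp Require Import all_classical all_reals all_analysis.
From mathcomp Require Import complex.
Import Order.TTheory GRing.Theory Num.Theory.
Import numFieldNormedType.Exports.

Set Implicit Arguments.
Unset Strict Implicit.
Unset Printing Implicit Defensive.

Local Open Scope classical_set_scope.
Local Open Scope ring_scope.
Local Open Scope complex_scope.

(* [R[i]^o] is [R[i]] as a normed module over itself, so the increments in
   [derivable] are complex: this is complex differentiability at every point. *)
Definition entire (R : realType) (F : R[i] -> R[i]) : Prop :=
  forall z : R[i], derivable (F : R[i]^o -> R[i]^o) z 1.

(* The plane is identified with [R * R] through [(x, y) |-> x +i* y];
   [Normc.normc] is the modulus with values in [R], whereas [`|z|] is the same
   number seen in [R[i]]. The value is [+oo] when the integral diverges. *)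
Definition fock_norm (R : realType) (F : R[i] -> R[i]) : \bar R :=
  sqrte ((pi^-1)%:E *
    \int[(@lebesgue_measure R \x @lebesgue_measure R)%E]_p
      (Normc.normc (F (p.1 +i* p.2)) ^+ 2 *
       expR (- (Normc.normc (p.1 +i* p.2) ^+ 2)))%:E)%E.

Definition fock_space (R : realType) : set (R[i] -> R[i]) :=
  [set F | entire F /\ (fock_norm F < +oo)%E].

(* Main.v *)
Require Import Defs.
From HB Require Import structures.
From mathcomp Require Import all_boot all_order all_algebra.
From mathcomp Require Import all_classical all_reals all_analysis.
From mathcomp Require Import complex measurable_realfun ring lra.
Import Order.TTheory GRing.Theory Num.Theory.
Import numFieldNormedType.Exports.
Set Implicit Arguments.
Unset Strict Implicit.
Unset Printing Implicit Defensive.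
Local Open Scope classical_set_scope.
Local Open Scope ring_scope.
Local Open Scope complex_scope.

(** Two facts combine.

    Local estimate: on a square of center [w], the mean of [|F - F w|^2] is at most a
    constant times the mean of [(|F| - 1)^2] on a larger one. If [|F| >= 1/2]
    there, apply the mean value property to [F] and to [1 / F]: since [1 / x] is
    [2 - x] up to [O ((x - 1)^2)], the second one yields [|F w| >= m - O (delta^2)],
    where [m] is the mean of [|F|] and [delta^2] that of [(|F| - 1)^2], and the
    variance of [F] is then [O (delta^2)]. Otherwise [|F|] is at most [3/4] on a small
    square, unless [delta] is bounded below anyway.

    Propagation: at scale [B / |z|] the weight [exp (- |z|^2)] is constant up to a
    factor depending on [B], and the local estimate compares [F z] with [F u] for [u] a
    bit closer to the origin, with [|u|^2 <= |z|^2 - B / 4]. Integrating in [z], the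
    change of weight gains [exp (- B / 4)], so for [B] large
    [norm (F - F 0)^2 <= K * norm (|F| - 1)^2 + norm (F - F 0)^2 / 2].

    One then takes [lambda = F 0 / |F 0|]. The mean value property holds for the
    kernel [max (1 - |z|^2 / t^2) 0] and is obtained from complex differentiability
    alone by Goursat's subdivision argument, applied to [F] times a compactly
    supported function whose dbar derivative is the difference of two kernels. *)

(** The scale [B / |z|] is dictated by the weight: a displacement of that size changes [|z|^2] by
    [O (B)], yet half of it, directed inwards, already lowers [|z|^2] by about [B]. The loss
    [exp (33 * B)] falls only on the term in [|F| - 1], where any constant is allowed. On the disc
    [|z|^2 < A2], where the propagation is not applied, one large square and the lower bound of the
    weight on it suffice.

    Absorbing half of [norm (F - F 0)^2] requires this quantity to be finite: this is where
    finiteness of the Fock norm of [F] enters.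

    The kernel [max (1 - |z|^2 / t^2) 0] has three virtues: it is continuous, as the divergence in
    Green's formula must be; it has an explicit primitive for dbar; and it is Lipschitz in its
    center, so that mean values around two close points can be compared. *)

(** * Bisection of squares, and integrals over squares and their edges *)

(** If [P] failed on the square, it would fail on one of its quarters, and so on. The failing
    squares shrink to a common point, where the local hypothesis is contradicted. This compactness
    principle serves both [cont2_bounded] and Goursat's argument. *)
Lemma square_bisection (R : realType) (P : R -> R -> R -> Prop) (a c s : R) :
  0 < s ->
  (forall a c s, 0 < s -> P a c s -> P (a + s) c s -> P a (c + s) s ->
     P (a + s) (c + s) s -> P a c (s + s)) ->
  (forall x y, a <= x <= a + s -> c <= y <= c + s ->
     exists2 d, 0 < d & forall a' c' s', 0 < s' < d ->
       a' <= x <= a' + s' -> c' <= y <= c' + s' ->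
       a <= a' -> a' + s' <= a + s -> c <= c' -> c' + s' <= c + s ->
       P a' c' s') ->
  P a c s.
Proof.
move=> s0 Psplit Ploc; apply: contrapT => nP.
pose sd n : R := s / 2 ^+ n.
have sd0 n : 0 < sd n by rewrite divr_gt0// exprn_gt0.
have sdS n : sd n = sd n.+1 + sd n.+1.
  by rewrite /sd exprS; field; rewrite expf_neq0.
(* Failure is a premise inside the existential, so that a successor exists for every corner [q] and
   [choice] applies. *)
have step (n : nat) (q : R * R) : exists q' : R * R,
    ~ P q.1 q.2 (sd n) -> [/\ ~ P q'.1 q'.2 (sd n.+1),
      q.1 <= q'.1, q'.1 + sd n.+1 <= q.1 + sd n, q.2 <= q'.2 &
      q'.2 + sd n.+1 <= q.2 + sd n].
  have [Pq|nPq] := pselect (P q.1 q.2 (sd n)); first by exists q.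
  have := sd0 n.+1; have := sdS n; set e := sd n.+1; move=> -> e0.
  apply: contrapT => H; apply: nPq; rewrite sdS -/e.
  by apply: Psplit => //; apply: contrapT => nPq'; apply: H;
    [exists (q.1, q.2)|exists (q.1 + e, q.2)|exists (q.1, q.2 + e)
    |exists (q.1 + e, q.2 + e)] => _; split=> //=; lra.
have [nx nxP] := choice (fun nq : nat * (R * R) => step nq.1 nq.2).
pose fix q n : R * R := if n is m.+1 then nx (m, q m) else (a, c).
have qP n : ~ P (q n).1 (q n).2 (sd n).
  by elim: n => [|n IH]; [rewrite /sd expr0 divr1|case: (nxP (n, q n) IH)].
have qS n : [/\ (q n).1 <= (q n.+1).1,
    (q n.+1).1 + sd n.+1 <= (q n).1 + sd n, (q n).2 <= (q n.+1).2 &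
    (q n.+1).2 + sd n.+1 <= (q n).2 + sd n] by case: (nxP (n, q n) (qP n)).
have qD n k : [/\ (q n).1 <= (q (n + k)%N).1,
    (q (n + k)%N).1 + sd (n + k)%N <= (q n).1 + sd n,
    (q n).2 <= (q (n + k)%N).2 &
    (q (n + k)%N).2 + sd (n + k)%N <= (q n).2 + sd n].
  elim: k => [|k [h1 h2 h3 h4]]; first by rewrite addn0.
  rewrite addnS; have [g1 g2 g3 g4] := qS (n + k)%N.
  by split; [exact: le_trans g1|exact: le_trans h2|exact: le_trans g3|
             exact: le_trans h4].
have nested (f : nat -> R) :
    (forall n k, f n <= f (n + k)%N /\ f (n + k)%N + sd (n + k)%N <= f n + sd n) ->
    exists x, forall n, f n <= x <= f n + sd n.
  move=> fD; exists (sup (range f)) => n.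
  have ub m : ubound (range f) (f m + sd m).
    move=> _ [k _ <-]; have [h1 h2] := fD m k; have [h3 h4] := fD k m.
    by rewrite addnC in h3; have := sd0 (m + k)%N; lra.
  apply/andP; split.
    by apply: ub_le_sup; [exists (f 0 + sd 0)|exists n].
  by apply: ge_sup => //; exists (f 0), 0.
have [x xP] := nested (fun n => (q n).1) (fun n k => let: And4 h1 h2 _ _ := qD n k in conj h1 h2).
have [y yP] := nested (fun n => (q n).2) (fun n k => let: And4 _ _ h1 h2 := qD n k in conj h1 h2).
have sd_0 : sd 0%N = s by rewrite /sd expr0 divr1.
have := xP 0%N; have := yP 0%N; rewrite /= sd_0 => yI xI.
have [d d0 dP] := Ploc _ _ xI yI.
have [n nd] : exists n, sd n < d.
  (* For this [n], [s / d < n < 2 ^ n]. *)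
  exists (Num.bound (s / d)); rewrite ltr_pdivrMr ?exprn_gt0// mulrC -ltr_pdivrMr//.
  have := archi_boundP (ltW (divr_gt0 s0 d0)) => /lt_le_trans; apply.
  by rewrite -natrX ler_nat ltnW// ltn_expl.
have [h1 h2 h3 h4] := qD 0%N n.
rewrite /= add0n sd_0 in h1 h2 h3 h4.
by apply: (qP n); apply: dP => //; rewrite sd0.
Qed.

Definition cont2 (R : realType) (f : R * R -> R) (p : R * R) : Prop :=
  forall e : R, 0 < e -> exists2 d : R, 0 < d & forall x y, `|x| < d -> `|y| < d ->
    `|f (p.1 + x, p.2 + y) - f p| <= e.

(** Fréchet differentiability at the single point [p], with gradient [(fx, fy)]. *)
Definition diff2 (R : realType) (f : R * R -> R) (p : R * R) (fx fy : R) : Prop :=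
  forall e : R, 0 < e -> exists2 d : R, 0 < d & forall x y, `|x| < d -> `|y| < d ->
    `|f (p.1 + x, p.2 + y) - f p - (fx * x + fy * y)| <= e * (`|x| + `|y|).

Lemma diff2_cont2 (R : realType) (f : R * R -> R) p fx fy :
  diff2 f p fx fy -> cont2 f p.
Proof.
move=> df e e0; have [d d0 dP] := df 1 ltr01.
pose K := 1 + `|fx| + `|fy|.
have K0 : 0 < K by rewrite /K -addrA ltr_wpDr// addr_ge0.
exists (Num.min d (e / (K + K))); first by rewrite lt_min d0 divr_gt0// addr_gt0.
move=> x y; rewrite !lt_min => /andP[xd xe] /andP[yd ye].
have := dP _ _ xd yd; rewrite mul1r => H.
have Kx : K * (`|x| + `|y|) <= e.
  rewrite -ler_pdivlMl//; move: xe ye.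
  by set k := (e / (K + K)); have -> : K^-1 * e = k + k;
    [rewrite /k; field; lra|lra].
apply: le_trans Kx.
have -> : f (p.1 + x, p.2 + y) - f p = (f (p.1 + x, p.2 + y) - f p - (fx * x + fy * y))
  + (fx * x + fy * y) by ring.
apply: le_trans (ler_normD _ _) _; apply: le_trans (lerD H (ler_normD _ _)) _.
rewrite !normrM /K; have := normr_ge0 x; have := normr_ge0 y.
have := normr_ge0 fx; have := normr_ge0 fy; nra.
Qed.

(** Half-open, so that the four quarters of a square form an exact partition. *)
Definition csquare (R : realType) (a c s : R) : set (R * R) :=
  `[a, a + s[ `*` `[c, c + s[.

Section plane.
Variable R : realType.
Notation mu := (@lebesgue_measure R).
Notation mu2 := (mu \x mu)%E.
Notation T2 := (measurableTypeR R * measurableTypeR R)%type.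

Lemma measurable_csquare (a c s : R) : measurable (csquare a c s : set T2).
Proof. by apply: measurableX. Qed.

Lemma measure_csquare (a c s : R) : 0 <= s -> mu2 (csquare a c s) = (s ^+ 2)%:E.
Proof.
move=> s0; rewrite product_measure1E//= !lebesgue_measure_itv/= !lte_fin.
rewrite !ltrDl; case: ltP => [|s0']; first by rewrite ![(_ + s)%R]addrC -!EFinD !addrK.
by have -> : s = 0 by [lra]; rewrite mul0e expr0n.
Qed.

Lemma integrable_csquare (f : R * R -> R) (a c s M : R) : 0 <= s ->
  measurable_fun setT (f : T2 -> R) -> (forall p, csquare a c s p -> `|f p| <= M) ->
  mu2.-integrable (csquare a c s) (EFin \o f).
Proof.
move=> s0 mf fM; apply: measurable_bounded_integrable.
- exact: measurable_csquare.
- by rewrite [X in (X < _)%E]measure_csquare// ltry.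
- exact: measurable_funTS.
- exists M; split; first exact: num_real.
  by move=> x Mx p /fM /le_trans; apply; exact: ltW.
Qed.

Lemma csquare_split (a c s : R) : 0 < s ->
  csquare a c (s + s) = (csquare a c s `|` csquare (a + s) c s) `|`
    (csquare a (c + s) s `|` csquare (a + s) (c + s) s).
Proof.
move=> s0; apply/seteqP; split=> [[x y]|[x y]]; rewrite /csquare/= !in_itv/=.
  move=> [/andP[h1 h2] /andP[h3 h4]].
  case: (ltP x (a + s)) => hx; case: (ltP y (c + s)) => hy;
    [left; left|right; left|left; right|right; right]; lra.
by move=> [[[/andP[h1 h2] /andP[h3 h4]]|[/andP[h1 h2] /andP[h3 h4]]]
  |[[/andP[h1 h2] /andP[h3 h4]]|[/andP[h1 h2] /andP[h3 h4]]]]; split; lra.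
Qed.

Lemma int_csquare_split (f : R * R -> R) (a c s : R) : 0 < s ->
  mu2.-integrable (csquare a c (s + s)) (EFin \o f) ->
  \int[mu2]_(p in csquare a c (s + s)) f p =
  (\int[mu2]_(p in csquare a c s) f p + \int[mu2]_(p in csquare (a + s) c s) f p)
  + (\int[mu2]_(p in csquare a (c + s) s) f p +
     \int[mu2]_(p in csquare (a + s) (c + s) s) f p).
Proof.
move=> s0; have mQ := measurable_csquare.
rewrite csquare_split// => fi.
have mU a1 c1 a2 c2 : measurable (csquare a1 c1 s `|` csquare a2 c2 s : set T2).
  by apply: measurableU; exact: mQ.
have disjP (A B : set (R * R)) : (forall p, A p -> B p -> False) -> [disjoint A & B].
  by move=> AB; apply/disj_setPS => p [] /AB.
rewrite (Rintegral_setU (mU _ _ _ _) (mU _ _ _ _) fi); last first.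
  apply: disjP => -[x y]; rewrite /csquare/= !in_itv/=.
  by move=> [[/andP[h1 h2] /andP[h3 h4]]|[/andP[h1 h2] /andP[h3 h4]]]
    [[/andP[h5 h6] /andP[h7 h8]]|[/andP[h5 h6] /andP[h7 h8]]]; lra.
have disjQ x1 y1 x2 y2 : x2 - x1 >= s -> [disjoint csquare x1 y1 s & csquare x2 y2 s].
  move=> h; apply: disjP => -[x y]; rewrite /csquare/= !in_itv/=.
  by move=> [/andP[h1 h2] /andP[h3 h4]] [/andP[h5 h6] /andP[h7 h8]]; lra.
have sub1 : csquare a c s `|` csquare (a + s) c s `<=`
  csquare a c s `|` csquare (a + s) c s `|`
  (csquare a (c + s) s `|` csquare (a + s) (c + s) s) by move=> p; left.
have sub2 : csquare a (c + s) s `|` csquare (a + s) (c + s) s `<=`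
  csquare a c s `|` csquare (a + s) c s `|`
  (csquare a (c + s) s `|` csquare (a + s) (c + s) s) by move=> p; right.
have mUU := measurableU _ _ (mU a c (a + s) c) (mU a (c + s) (a + s) (c + s)).
rewrite (Rintegral_setU (mQ _ _ _) (mQ _ _ _) (integrableS mUU (mU _ _ _ _) sub1 fi)).
  rewrite (Rintegral_setU (mQ _ _ _) (mQ _ _ _) (integrableS mUU (mU _ _ _ _) sub2 fi))//.
  by apply: disjQ; lra.
by apply: disjQ; lra.
Qed.

Lemma int_itv_split (f : R -> R) (c s : R) : 0 < s ->
  {within `[c, c + (s + s)], continuous f} ->
  \int[mu]_(y in `[c, c + (s + s)]) f y =
  \int[mu]_(y in `[c, c + s]) f y + \int[mu]_(y in `[c + s, c + s + s]) f y.
Proof.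
move=> s0 cf.
have fi : mu.-integrable `[c, c + (s + s)] (EFin \o f).
  by apply: continuous_compact_integrable => //; exact: segment_compact.
rewrite -(@Rintegral_itv_obnd_cbnd _ (c + s)); last first.
  by apply: integrableS fi => //; apply: subset_itv; rewrite bnd_simp; lra.
have -> : c + s + s = c + (s + s) by ring.
rewrite -(@Rintegral_itvB _ _ (BLeft c) (BRight (c + (s + s))) (c + s))//.
- by ring.
- by rewrite bnd_simp; lra.
- by rewrite bnd_simp; lra.
Qed.

Lemma int_itv_approx (f : R -> R) (c s k e : R) : 0 <= s ->
  mu.-integrable `[c, c + s] (EFin \o f) ->
  (forall y, c <= y <= c + s -> `|f y - k| <= e) ->
  `|\int[mu]_(y in `[c, c + s]) f y - k * s| <= e * s.
Proof.
move=> s0 fi fk.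
have ms : fine (mu `[c, c + s]) = s.
  rewrite lebesgue_measure_itv/= lte_fin ltrDl; case: ltP => /= h; last by lra.
  by ring.
have ci r : mu.-integrable `[c, c + s] (EFin \o cst r).
  apply/(@continuous_compact_integrable _ (cst r)); first exact: segment_compact.
  by apply: continuous_subspaceT => x; exact: cvg_cst.
have <- : \int[mu]_(y in `[c, c + s]) k = k * s by rewrite Rintegral_cst// ms.
have <- : \int[mu]_(y in `[c, c + s]) e = e * s by rewrite Rintegral_cst// ms.
rewrite -RintegralB//; last exact: ci.
have fki : mu.-integrable `[c, c + s] (EFin \o (fun y => f y - k)).
  by apply: (integrableB _ fi (ci k)).
apply: le_trans (le_normr_Rintegral _ fki) _ => //.
apply: le_Rintegral => //.
- exact: (integrable_norm fki).
- exact: ci.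
Qed.

Lemma int_csquare_approx (f : R * R -> R) (a c s k e : R) : 0 <= s ->
  mu2.-integrable (csquare a c s) (EFin \o f) ->
  (forall p, csquare a c s p -> `|f p - k| <= e) ->
  `|\int[mu2]_(p in csquare a c s) f p - k * s ^+ 2| <= e * s ^+ 2.
Proof.
move=> s0 fi fk; have mQ := measurable_csquare a c s.
have ms : fine (mu2 (csquare a c s)) = s ^+ 2 by rewrite [X in fine X]measure_csquare.
have ci r : mu2.-integrable (csquare a c s) (EFin \o cst r).
  by apply: (integrable_csquare (M := `|r|)).
have <- : \int[mu2]_(y in csquare a c s) k = k * s ^+ 2 by rewrite Rintegral_cst// ms.
have <- : \int[mu2]_(y in csquare a c s) e = e * s ^+ 2 by rewrite Rintegral_cst// ms.
rewrite -RintegralB//; last exact: ci.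
have fki : mu2.-integrable (csquare a c s) (EFin \o (fun y => f y - k)).
  by apply: (integrableB _ fi (ci k)).
apply: le_trans (le_normr_Rintegral _ fki) _ => //.
apply: le_Rintegral => //.
- exact: (integrable_norm fki).
- exact: ci.
Qed.

Lemma cont2_bounded (f : R * R -> R) (a c s : R) : 0 < s ->
  (forall x y, a <= x <= a + s -> c <= y <= c + s -> cont2 f (x, y)) ->
  exists M, forall p, csquare a c s p -> `|f p| <= M.
Proof.
move=> s0 cf.
apply: (square_bisection
  (P := fun a c s => exists M, forall p, csquare a c s p -> `|f p| <= M)) => //.
  move=> a' c' s' s'0 [M1 H1] [M2 H2] [M3 H3] [M4 H4].
  exists (`|M1| + `|M2| + `|M3| + `|M4|) => p; rewrite csquare_split//.
  have := ler_norm M1; have := ler_norm M2; have := ler_norm M3; have := ler_norm M4.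
  have := normr_ge0 M1; have := normr_ge0 M2; have := normr_ge0 M3; have := normr_ge0 M4.
  by move=> ? ? ? ? ? ? ? ? [[/H1|/H2]|[/H3|/H4]]; lra.
move=> x y xI yI; have [d d0 dP] := cf _ _ xI yI 1 ltr01.
exists d => // a' c' s' /andP[s'0 s'd] /andP[x1 x2] /andP[y1 y2] _ _ _ _.
exists (1 + `|f (x, y)|) => -[u v]; rewrite /csquare/= !in_itv/= => -[/andP[u1 u2] /andP[v1 v2]].
have := dP (u - x) (v - y); rewrite /= !subrKC => H.
have -> : f (u, v) = (f (u, v) - f (x, y)) + f (x, y) by ring.
apply: le_trans (ler_normD _ _) _; rewrite lerD2r; apply: H.
  by rewrite ltr_norml; apply/andP; split; lra.
by rewrite ltr_norml; apply/andP; split; lra.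
Qed.

(** Outward flux of the field [(A, B)] through the boundary of the square. *)
Definition flux (A B : R * R -> R) (a c s : R) : R :=
  (\int[mu]_(y in `[c, c + s]) A (a + s, y) - \int[mu]_(y in `[c, c + s]) A (a, y)) +
  (\int[mu]_(x in `[a, a + s]) B (x, c + s) - \int[mu]_(x in `[a, a + s]) B (x, c)).
End plane.

(** * Green's formula on squares without continuous partial derivatives *)

Section green.
Variable R : realType.
Notation mu := (@lebesgue_measure R).
Notation mu2 := (mu \x mu)%E.
Notation T2 := (measurableTypeR R * measurableTypeR R)%type.

Lemma slice1_continuous (f : R * R -> R) (x c s : R) :
  (forall y, c <= y <= c + s -> cont2 f (x, y)) ->
  {within `[c, c + s], continuous (fun y => f (x, y))}.
Proof.
move=> cf; apply: continuous_in_subspaceT => y; rewrite inE/= in_itv/= => /cf fy.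
apply/cvgrPdist_le => e e0; have [d d0 dP] := fy e e0.
near=> t; rewrite distrC.
have := dP 0 (t - y); rewrite /= addr0 subrKC normr0; apply=> //.
Unshelve. all: by end_near. Qed.

Lemma slice2_continuous (f : R * R -> R) (y a s : R) :
  (forall x, a <= x <= a + s -> cont2 f (x, y)) ->
  {within `[a, a + s], continuous (fun x => f (x, y))}.
Proof.
move=> cf; apply: continuous_in_subspaceT => x; rewrite inE/= in_itv/= => /cf fx.
apply/cvgrPdist_le => e e0; have [d d0 dP] := fx e e0.
near=> t; rewrite distrC.
have := dP (t - x) 0; rewrite /= addr0 subrKC normr0; apply=> //.
Unshelve. all: by end_near. Qed.

Lemma int_itv_diff_approx (f1 f2 : R -> R) (c s k e : R) : 0 <= s ->
  {within `[c, c + s], continuous f1} -> {within `[c, c + s], continuous f2} ->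
  (forall y, c <= y <= c + s -> `|f1 y - f2 y - k| <= e) ->
  `|\int[mu]_(y in `[c, c + s]) f1 y - \int[mu]_(y in `[c, c + s]) f2 y - k * s|
    <= e * s.
Proof.
move=> s0 c1 c2 H.
have i1 : mu.-integrable `[c, c + s] (EFin \o f1).
  by apply: continuous_compact_integrable => //; exact: segment_compact.
have i2 : mu.-integrable `[c, c + s] (EFin \o f2).
  by apply: continuous_compact_integrable => //; exact: segment_compact.
rewrite -RintegralB//; apply: int_itv_approx => //.
exact: (integrableB _ i1 i2).
Qed.

Lemma itv_dist_le (a s x u : R) :
  a <= x <= a + s -> a <= u <= a + s -> `|u - x| <= s.
Proof. by rewrite ler_norml; lra. Qed.

Lemma quarter_sum (e s : R) : e * (s + s) ^+ 2 =
  e * s ^+ 2 + e * s ^+ 2 + (e * s ^+ 2 + e * s ^+ 2).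
Proof. by ring. Qed.

Lemma normB4_le (f1 f2 f3 f4 i1 i2 i3 i4 e : R) :
  `|f1 - i1| <= e -> `|f2 - i2| <= e -> `|f3 - i3| <= e -> `|f4 - i4| <= e ->
  `|(f1 + f2 + (f3 + f4)) - (i1 + i2 + (i3 + i4))| <= e + e + (e + e).
Proof.
rewrite !ler_norml => /andP[? ?] /andP[? ?] /andP[? ?] /andP[? ?].
by apply/andP; split; lra.
Qed.

(** The contributions of the inner edges cancel in pairs. *)
Lemma flux_split (A B : R * R -> R) (a c s : R) : 0 < s ->
  (forall x, a <= x <= a + (s + s) ->
     {within `[c, c + (s + s)], continuous (fun y => A (x, y))}) ->
  (forall y, c <= y <= c + (s + s) ->
     {within `[a, a + (s + s)], continuous (fun x => B (x, y))}) ->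
  flux A B a c (s + s) = (flux A B a c s + flux A B (a + s) c s) +
    (flux A B a (c + s) s + flux A B (a + s) (c + s) s).
Proof.
move=> s0 Ac Bc; rewrite /flux !int_itv_split//;
  do ?[by apply: Ac; lra|by apply: Bc; lra].
by rewrite !addrA; ring.
Qed.

(** Both ends of each increment are compared with the linear part of [f] at the same point [(x, y)],
    each up to [2 * e * s]. *)
Lemma diff2_increments (f : R * R -> R) (x y fx fy e d a c s : R) : 0 < e ->
  s < d -> a <= x <= a + s -> c <= y <= c + s ->
  (forall u v, `|u| < d -> `|v| < d ->
    `|f ((x, y).1 + u, (x, y).2 + v) - f (x, y) - (fx * u + fy * v)| <=
    e * (`|u| + `|v|)) ->
  (forall v, c <= v <= c + s -> `|f (a + s, v) - f (a, v) - fx * s| <= 4 * e * s) /\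
  (forall u, a <= u <= a + s -> `|f (u, c + s) - f (u, c) - fy * s| <= 4 * e * s).
Proof.
move=> e0 sd /andP[x1 x2] /andP[y1 y2] fP.
have H u v : a <= u <= a + s -> c <= v <= c + s ->
    `|f (u, v) - f (x, y) - (fx * (u - x) + fy * (v - y))| <= e * (s + s).
  move=> /andP[u1 u2] /andP[v1 v2].
  have hu : `|u - x| <= s by rewrite ler_norml; lra.
  have hv : `|v - y| <= s by rewrite ler_norml; lra.
  have := fP _ _ (le_lt_trans hu sd) (le_lt_trans hv sd); rewrite /= !subrKC.
  by move=> /le_trans; apply; rewrite ler_pM2l// lerD.
have s0 : 0 <= s by lra.
split=> [v vI|u uI].
  have := H a v; have := H (a + s) v.
  rewrite !lexx !lerDl s0 vI /= !ler_norml => /(_ isT isT) /andP[h1 h2] /(_ isT isT) /andP[h3 h4].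
  by apply/andP; split; lra.
have := H u c; have := H u (c + s).
rewrite !lexx !lerDl s0 uI /= !ler_norml => /(_ isT isT) /andP[h1 h2] /(_ isT isT) /andP[h3 h4].
by apply/andP; split; lra.
Qed.

(** Origin of [eta / 9]: two edge terms with factor [4] and the area term with factor [1]. *)
Lemma flux_error (p1 p2 q1 q2 i u v eta s : R) :
  `|p1 - p2 - u * s * s| <= 4 * (eta / 9) * s * s ->
  `|q1 - q2 - v * s * s| <= 4 * (eta / 9) * s * s ->
  `|i - (u + v) * s ^+ 2| <= eta / 9 * s ^+ 2 ->
  `|p1 - p2 + (q1 - q2) - i| <= eta * s ^+ 2.
Proof.
rewrite !ler_norml => /andP[? ?] /andP[? ?] /andP[? ?].
by apply/andP; split; lra.
Qed.

(* Goursat's argument: the error is additive over subdivisions and [o (s ^+ 2)] at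
   every point. Only the divergence [g] is assumed continuous. *)
Lemma green_square (A B g : R * R -> R) (a c s : R) : 0 < s ->
  measurable_fun setT (g : T2 -> R) ->
  (forall x y, a <= x <= a + s -> c <= y <= c + s -> cont2 g (x, y) /\
     exists ax ay bx by_, [/\ diff2 A (x, y) ax ay, diff2 B (x, y) bx by_ &
       ax + by_ = g (x, y)]) ->
  flux A B a c s = \int[mu2]_(p in csquare a c s) g p.
Proof.
move=> s0 mg H.
have cg x y : a <= x <= a + s -> c <= y <= c + s -> cont2 g (x, y).
  by move=> hx hy; have [] := H _ _ hx hy.
have cA x y : a <= x <= a + s -> c <= y <= c + s -> cont2 A (x, y).
  by move=> hx hy; have [_ [ax [ay [bx [by_ [/diff2_cont2]]]]]] := H _ _ hx hy.
have cB x y : a <= x <= a + s -> c <= y <= c + s -> cont2 B (x, y).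
  by move=> hx hy; have [_ [ax [ay [bx [by_ [_ /diff2_cont2]]]]]] := H _ _ hx hy.
have [M gM] := cont2_bounded s0 cg.
pose inside (a' c' s' : R) := [/\ a <= a', a' + s' <= a + s, c <= c' & c' + s' <= c + s].
have gi (a' c' s' : R) : 0 < s' -> inside a' c' s' ->
    mu2.-integrable (csquare a' c' s') (EFin \o g).
  move=> s'0 [h1 h2 h3 h4]; apply: (integrable_csquare (M := M)) => //; first exact: ltW.
  move=> [x y] []/=; rewrite !in_itv/= => /andP[g1 g2] /andP[g3 g4].
  by apply: gM; rewrite /csquare/= !in_itv/=; split; lra.
have Ac x a' c' s' : inside a' c' s' -> a' <= x <= a' + s' ->
    {within `[c', c' + s'], continuous (fun y => A (x, y))}.
  by move=> [h1 h2 h3 h4] xI; apply: slice1_continuous => y yI; apply: cA; lra.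
have Bc y a' c' s' : inside a' c' s' -> c' <= y <= c' + s' ->
    {within `[a', a' + s'], continuous (fun x => B (x, y))}.
  by move=> [h1 h2 h3 h4] yI; apply: slice2_continuous => x xI; apply: cB; lra.
suff Hd (eta : R) : 0 < eta ->
    `|flux A B a c s - \int[mu2]_(p in csquare a c s) g p| <= eta * s ^+ 2.
  apply/eqP; rewrite -subr_eq0 -normr_le0; apply/ler_addgt0Pl => e e0.
  rewrite addr0; have := Hd (e / s ^+ 2) (divr_gt0 e0 (exprn_gt0 2 s0)).
  by rewrite divfK// expf_neq0// gt_eqF.
move=> eta0.
suff : inside a c s -> `|flux A B a c s - \int[mu2]_(p in csquare a c s) g p|
    <= eta * s ^+ 2 by apply; split.
pose P (a' c' s' : R) := inside a' c' s' ->
  `|flux A B a' c' s' - \int[mu2]_(p in csquare a' c' s') g p| <= eta * s' ^+ 2.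
apply: (square_bisection (P := P)) => //.
- move=> a' c' s' s'0 P1 P2 P3 P4 inn; have [h1 h2 h3 h4] := inn.
  have i1 : inside a' c' s' by split; lra.
  have i2 : inside (a' + s') c' s' by split; lra.
  have i3 : inside a' (c' + s') s' by split; lra.
  have i4 : inside (a' + s') (c' + s') s' by split; lra.
  move: (P1 i1) (P2 i2) (P3 i3) (P4 i4) => {}P1 {}P2 {}P3 {}P4.
  rewrite int_csquare_split//; last by apply: gi => //; lra.
  rewrite (flux_split s'0) => [|x xI|y yI]; last 2 first.
  - by apply: (Ac _ a' c'); [exact: inn|lra].
  - by apply: (Bc _ a' c'); [exact: inn|lra].
  rewrite (quarter_sum eta s').
  exact: normB4_le P1 P2 P3 P4.
- move=> x y xI yI; have [_ [ax [ay [bx [by_ [dA dB gE]]]]]] := H _ _ xI yI.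
  have e0 : 0 < eta / 9 by lra.
  have [d1 d10 dP1] := dA _ e0; have [d2 d20 dP2] := dB _ e0.
  have [d3 d30 dP3] := cg _ _ xI yI _ e0.
  exists (Num.min d1 (Num.min d2 d3)); first by rewrite !lt_min d10 d20 d30.
  move=> a' c' s'; rewrite !lt_min => /andP[s'0 /and3P[sd1 sd2 sd3]] /andP[x1 x2]
    /andP[y1 y2] _ _ _ _ inn.
  have s'0' := ltW s'0.
  have xI' : a' <= x <= a' + s' by rewrite x1.
  have yI' : c' <= y <= c' + s' by rewrite y1.
  have [F1 _] := diff2_increments e0 sd1 xI' yI' dP1.
  have [_ F2] := diff2_increments e0 sd2 xI' yI' dP2.
  have as' : a' <= a' + s' by rewrite lerDl.
  have cs' : c' <= c' + s' by rewrite lerDl.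
  have E1 := int_itv_diff_approx s'0' (Ac (a' + s') _ _ _ inn ltac:(by rewrite as' lexx))
    (Ac a' _ _ _ inn ltac:(by rewrite as' lexx)) F1.
  have E2 := int_itv_diff_approx s'0' (Bc (c' + s') _ _ _ inn ltac:(by rewrite cs' lexx))
    (Bc c' _ _ _ inn ltac:(by rewrite cs' lexx)) F2.
  rewrite /flux; apply: (flux_error E1 E2); rewrite gE.
  apply: int_csquare_approx => //; first exact: gi.
  move=> [u v] []/=; rewrite !in_itv/= => /andP[u1 u2] /andP[v1 v2].
  have := dP3 (u - x) (v - y); rewrite /= !subrKC; apply.
    by apply: le_lt_trans sd3; apply: itv_dist_le xI' _; rewrite u1 ltW.
  by apply: le_lt_trans sd3; apply: itv_dist_le yI' _; rewrite v1 ltW.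
Qed.
End green.

(** * The mean value property *)

Section diff2_calculus.
Variable R : realType.
Implicit Types (f g : R * R -> R) (p : R * R).

Lemma cont2_cst (r : R) p : cont2 (fun=> r) p.
Proof. by move=> e e0; exists 1 => // x y _ _; rewrite subrr normr0 ltW. Qed.

Lemma cont2D f g p : cont2 f p -> cont2 g p -> cont2 (fun q => f q + g q) p.
Proof.
move=> cf cg e e0; have e20 : 0 < e / 2 by rewrite divr_gt0.
have [d1 d10 H1] := cf _ e20; have [d2 d20 H2] := cg _ e20.
exists (Num.min d1 d2); first by rewrite lt_min d10.
move=> x y; rewrite !lt_min => /andP[x1 x2] /andP[y1 y2].
rewrite opprD addrACA (splitr e).
by apply: le_trans (ler_normD _ _) _; rewrite lerD ?H1 ?H2.
Qed.

Lemma cont2M f g p : cont2 f p -> cont2 g p -> cont2 (fun q => f q * g q) p.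
Proof.
move=> cf cg e e0; pose K : R := `|f p| + `|g p| + 1.
have K0 : 0 < K by rewrite ltr_wpDl// addr_ge0.
have eK0 : 0 < e / K by rewrite divr_gt0.
have [d1 d10 H1] := cf _ eK0; have [d2 d20 H2] := cg _ eK0.
have [d3 d30 H3] := cf _ ltr01.
exists (Num.min d1 (Num.min d2 d3)); first by rewrite !lt_min d10 d20.
move=> x y; rewrite !lt_min => /and3P[x1 x2 x3] /and3P[y1 y2 y3].
have := H1 _ _ x1 y1; have := H2 _ _ x2 y2; have := H3 _ _ x3 y3.
set u := f (_, _); set v := g (_, _) => h3 h2 h1.
have -> : u * v - f p * g p = (u - f p) * g p + u * (v - g p) by ring.
have hu : `|u| <= 1 + `|f p|.
  by rewrite -[u](subrK (f p)); apply: le_trans (ler_normD _ _) _; rewrite lerD2r.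
apply: le_trans (ler_normD _ _) _; rewrite !normrM.
have -> : e = e / K * `|g p| + (1 + `|f p|) * (e / K).
  by rewrite /K; field; rewrite -/K gt_eqF.
by apply: lerD; [apply: ler_wpM2r|apply: ler_pM].
Qed.

Lemma cont2_lip (h : R -> R) f p : (forall u v, `|h u - h v| <= `|u - v|) ->
  cont2 f p -> cont2 (fun q => h (f q)) p.
Proof.
move=> hl cf e e0; have [d d0 H] := cf _ e0.
by exists d => // x y xd yd; apply: le_trans (hl _ _) _; exact: H.
Qed.

Lemma diff2_cst (r : R) p : diff2 (fun=> r) p 0 0.
Proof.
move=> e e0; exists 1 => // x y _ _.
by rewrite !mul0r addr0 subrr subr0 normr0 mulr_ge0 ?addr_ge0// ltW.
Qed.

Lemma diff2_fst p : diff2 (fun q => q.1) p 1 0.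
Proof.
move=> e e0; exists 1 => // x y _ _ /=.
rewrite (_ : _ - _ = 0); last by ring.
by rewrite normr0 mulr_ge0 ?addr_ge0// ltW.
Qed.

Lemma diff2_snd p : diff2 (fun q => q.2) p 0 1.
Proof.
move=> e e0; exists 1 => // x y _ _ /=.
rewrite (_ : _ - _ = 0); last by ring.
by rewrite normr0 mulr_ge0 ?addr_ge0// ltW.
Qed.

Lemma diff2D f g p fx fy gx gy : diff2 f p fx fy -> diff2 g p gx gy ->
  diff2 (fun q => f q + g q) p (fx + gx) (fy + gy).
Proof.
move=> cf cg e e0; have e20 : 0 < e / 2 by rewrite divr_gt0.
have [d1 d10 H1] := cf _ e20; have [d2 d20 H2] := cg _ e20.
exists (Num.min d1 d2); first by rewrite lt_min d10.
move=> x y; rewrite !lt_min => /andP[x1 x2] /andP[y1 y2].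
set u := f _; set v := g _.
have -> : u + v - (f p + g p) - ((fx + gx) * x + (fy + gy) * y) =
  (u - f p - (fx * x + fy * y)) + (v - g p - (gx * x + gy * y)) by ring.
rewrite [e in X in _ <= X]splitr mulrDl.
by apply: le_trans (ler_normD _ _) _; rewrite lerD ?H1 ?H2.
Qed.

Lemma diff2M f g p fx fy gx gy : diff2 f p fx fy -> diff2 g p gx gy ->
  diff2 (fun q => f q * g q) p (fx * g p + f p * gx) (fy * g p + f p * gy).
Proof.
move=> df dg e e0; pose K : R := `|g p| + 1 + (`|fx| + `|fy|) + `|f p|.
have K0 : 0 < K by rewrite /K -!addrA ltr_wpDl// ltr_pwDl// !addr_ge0.
have eK0 : 0 < e / K by rewrite divr_gt0.
have [d1 d10 H1] := df _ eK0; have [d2 d20 H2] := dg _ eK0.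
have [d3 d30 H3] := diff2_cont2 dg ltr01.
have [d4 d40 H4] := diff2_cont2 dg eK0.
exists (Num.min (Num.min d1 d2) (Num.min d3 d4)); first by rewrite !lt_min d10 d20 d30.
move=> x y; rewrite !lt_min => /andP[/andP[x1 x2] /andP[x3 x4]] /andP[/andP[y1 y2] /andP[y3 y4]].
have := H1 _ _ x1 y1; have := H2 _ _ x2 y2; have := H3 _ _ x3 y3; have := H4 _ _ x4 y4.
set u := f (_, _); set v := g (_, _) => h4 h3 h2 h1.
set N := `|x| + `|y| in h1 h2 *.
have -> : u * v - f p * g p - ((fx * g p + f p * gx) * x + (fy * g p + f p * gy) * y) =
  (u - f p - (fx * x + fy * y)) * v + (fx * x + fy * y) * (v - g p) +
  f p * (v - g p - (gx * x + gy * y)) by ring.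
have hv : `|v| <= `|g p| + 1.
  by rewrite -[v](subrK (g p)) addrC; apply: le_trans (ler_normD _ _) _; rewrite lerD2l.
have N0 : 0 <= N by rewrite addr_ge0.
have hf : `|fx * x + fy * y| <= (`|fx| + `|fy|) * N.
  apply: le_trans (ler_normD _ _) _; rewrite !normrM mulrDl.
  by apply: lerD; apply: ler_wpM2l => //; rewrite ?lerDl ?lerDr.
have -> : e * N = e / K * N * (`|g p| + 1) + (`|fx| + `|fy|) * N * (e / K) +
   `|f p| * (e / K * N) by rewrite /K; field; rewrite -/K gt_eqF.
by do 2?[apply: le_trans (ler_normD _ _) _; apply: lerD]; rewrite normrM;
  apply: ler_pM.
Qed.

Lemma diff2_comp (h : R -> R) (l : R) f p fx fy :
  (forall e, 0 < e -> exists2 d, 0 < d & forall v, `|v - f p| < d ->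
     `|h v - h (f p) - l * (v - f p)| <= e * `|v - f p|) ->
  diff2 f p fx fy -> diff2 (fun q => h (f q)) p (l * fx) (l * fy).
Proof.
move=> dh df e e0; pose K : R := `|fx| + `|fy| + 1 + `|l|.
have K0 : 0 < K by rewrite ltr_wpDr// ltr_wpDl// addr_ge0.
have eK0 : 0 < e / K by rewrite divr_gt0.
have [d1 d10 H1] := dh _ eK0; have [d2 d20 H2] := df _ eK0.
have [d3 d30 H3] := df _ ltr01.
have d120 : 0 < d1 / 2 by rewrite divr_gt0.
have [d4 d40 H4] := diff2_cont2 df d120.
exists (Num.min d2 (Num.min d3 d4)); first by rewrite !lt_min d20 d30.
move=> x y; rewrite !lt_min => /and3P[x2 x3 x4] /and3P[y2 y3 y4].
have := H2 _ _ x2 y2; have := H3 _ _ x3 y3; have := H4 _ _ x4 y4.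
set u := f (_, _) => h4 h3 h2.
have h1 : `|u - f p| < d1.
  by apply: le_lt_trans h4 _; rewrite ltr_pdivrMr// ltr_pMr// ltr1n.
move: h1 => /H1 h1.
set N := `|x| + `|y| in h2 h3 *.
have N0 : 0 <= N by rewrite addr_ge0.
have hf : `|fx * x + fy * y| <= (`|fx| + `|fy|) * N.
  apply: le_trans (ler_normD _ _) _; rewrite !normrM mulrDl.
  by apply: lerD; apply: ler_wpM2l => //; rewrite ?lerDl ?lerDr.
have hu : `|u - f p| <= (`|fx| + `|fy| + 1) * N.
  rewrite -[u - f p](subrK (fx * x + fy * y)).
  by apply: le_trans (ler_normD _ _) _; rewrite addrC mulrDl; apply: lerD.
have -> : h u - h (f p) - (l * fx * x + l * fy * y) =
  (h u - h (f p) - l * (u - f p)) + l * (u - f p - (fx * x + fy * y)) by ring.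
have -> : e * N = e / K * ((`|fx| + `|fy| + 1) * N) + `|l| * (e / K * N).
  by rewrite /K; field; rewrite -/K gt_eqF.
apply: le_trans (ler_normD _ _) _; apply: lerD.
  by apply: le_trans h1 _; rewrite ler_pM2l.
by rewrite normrM; apply: ler_wpM2l.
Qed.
End diff2_calculus.

(* With [v = |z|^2 / t^2], the function [(conj z / t^2) * inv_cutoff v] equals
   [1 / (2 z)] outside the disc of radius [t], and its dbar derivative is
   [max (1 - v) 0 / t^2] everywhere. *)
Definition inv_cutoff (R : realType) (v : R) : R :=
  if v <= 1 then 1 - v / 2 else (v * 2)^-1.

Definition inv_cutoff' (R : realType) (v : R) : R :=
  if v <= 1 then - 2^-1 else - (v ^+ 2 * 2)^-1.

Definition sqdist (R : realType) (w p : R * R) : R :=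
  (p.1 - w.1) ^+ 2 + (p.2 - w.2) ^+ 2.

Definition bump (R : realType) (w : R * R) (t : R) (p : R * R) : R :=
  Num.max (1 - sqdist w p / t ^+ 2) 0.

Section mean_value.
Variable R : realType.
Notation mu := (@lebesgue_measure R).
Notation mu2 := (mu \x mu)%E.
Notation T2 := (measurableTypeR R * measurableTypeR R)%type.

Lemma inv_cutoff_ge1 (v : R) : 1 <= v -> inv_cutoff v = (v * 2)^-1.
Proof.
rewrite /inv_cutoff; case: ltgtP => // <- _; lra.
Qed.

(** The two branches agree at [1] in value and in slope, and the second derivative is at most [1] on
    each side, so the Taylor remainder is quadratic with a uniform constant, even across [1]. *)
Lemma inv_cutoff_diff (v0 v : R) :
  `|inv_cutoff v - inv_cutoff v0 - inv_cutoff' v0 * (v - v0)| <= (v - v0) ^+ 2.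
Proof.
rewrite /inv_cutoff /inv_cutoff'; have [v1|v1] := leP v 1; have [v01|v01] := leP v0 1.
- rewrite (_ : _ - _ = 0) ?normr0 ?sqr_ge0//; lra.
- have v00 : 0 < v0 by lra.
  have -> : 1 - v / 2 - (v0 * 2)^-1 - - (v0 ^+ 2 * 2)^-1 * (v - v0) =
    ((v0 - v) * (v0 ^+ 2 - 1) - v0 * (v0 - 1) ^+ 2) / (v0 ^+ 2 * 2) by field; lra.
  have q0 : 0 < v0 ^+ 2 * 2 by rewrite mulr_gt0// exprn_gt0.
  rewrite ler_norml ler_pdivlMr// ler_pdivrMr//.
  (* Mixed case [v <= 1 < v0]: polynomial inequality in [a = v0 - 1] and [d = v0 - v], with
     [0 <= a <= d]. *)
  have [a [d [a0 ad -> dE]]] : exists a d, [/\ 0 <= a, a <= d, v0 = 1 + a & v = 1 + a - d].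
    by exists (v0 - 1), (v0 - v); split; lra.
  have -> : (v - (1 + a)) ^+ 2 * ((1 + a) ^+ 2 * 2) = d ^+ 2 * (1 + a) ^+ 2 * 2.
    by rewrite dE; ring.
  have -> : - (v - (1 + a)) ^+ 2 * ((1 + a) ^+ 2 * 2) = - (d ^+ 2 * (1 + a) ^+ 2 * 2).
    by rewrite dE; ring.
  have -> : (1 + a - v) * ((1 + a) ^+ 2 - 1) - (1 + a) * (1 + a - 1) ^+ 2 =
    d * a * (a + 2) - (1 + a) * (a * a) by rewrite dE; ring.
  have d0 : 0 <= d by exact: le_trans ad.
  have h1 : d * a <= d * d by exact: ler_wpM2l.
  have h2 : a * a <= d * d by exact: ler_pM.
  have h3 : d * a * (a + 2) <= d * d * (a + 2) by apply: ler_wpM2r => //; lra.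
  have h4 : (1 + a) * (a * a) <= (1 + a) * (d * d) by apply: ler_wpM2l => //; lra.
  have h5 : 0 <= d * d * a by rewrite !mulr_ge0.
  have h6 : 0 <= d * d * (a * a) by rewrite !mulr_ge0.
  have h7 : 0 <= d * d by rewrite mulr_ge0.
  have h8 : 0 <= d * a * (a + 2) by rewrite !mulr_ge0//; lra.
  have h9 : 0 <= (1 + a) * (a * a) by rewrite !mulr_ge0//; lra.
  have -> : d ^+ 2 * (1 + a) ^+ 2 * 2 = 2 * (d * d) + 4 * (d * d * a) + 2 * (d * d * (a * a)).
    by ring.
  by apply/andP; split; lra.
- have v00 : 0 < v by lra.
  have -> : (v * 2)^-1 - (1 - v0 / 2) - - 2^-1 * (v - v0) = (v - 1) ^+ 2 / (v * 2).
    by field; lra.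
  rewrite ger0_norm; last by rewrite divr_ge0 ?sqr_ge0//; lra.
  rewrite ler_pdivrMr; last by lra.
  have h : (v - 1) ^+ 2 <= (v - v0) ^+ 2 by rewrite !expr2; apply: ler_pM; lra.
  by apply: le_trans h _; rewrite ler_peMr ?sqr_ge0//; lra.
- have v00 : 0 < v0 by lra.
  have v10 : 0 < v by lra.
  have -> : (v * 2)^-1 - (v0 * 2)^-1 - - (v0 ^+ 2 * 2)^-1 * (v - v0) =
     (v - v0) ^+ 2 / (v * v0 ^+ 2 * 2) by field; lra.
  have q1 : 1 <= v * v0 ^+ 2 * 2.
    have := ler_pM ler01 ler01 (ltW v01) (ltW v01).
    by rewrite mulr1 expr2 => h; nra.
  rewrite ger0_norm; last by rewrite divr_ge0 ?sqr_ge0//; lra.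
  rewrite ler_pdivrMr; last by lra.
  by rewrite ler_peMr// sqr_ge0.
Qed.

(** The left-hand side is the derivative of [v * inv_cutoff v], that is, half the divergence of the
    plane field [z * inv_cutoff (|z|^2)]. *)
Lemma inv_cutoff_euler (v : R) : inv_cutoff v + v * inv_cutoff' v = Num.max (1 - v) 0.
Proof.
rewrite /inv_cutoff /inv_cutoff'; case: (leP v 1) => v1.
  by rewrite max_l; [field|rewrite subr_ge0].
by rewrite max_r; [field; lra|rewrite subr_le0 ltW].
Qed.

Lemma diff2_eq (f : R * R -> R) p fx fy gx gy :
  diff2 f p fx fy -> fx = gx -> fy = gy -> diff2 f p gx gy.
Proof. by move=> h <- <-. Qed.

Lemma sqdist_diff (w p : R * R) :
  diff2 (sqdist w) p (2 * (p.1 - w.1)) (2 * (p.2 - w.2)).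
Proof.
have d1 := diff2D (diff2_fst p) (diff2_cst (- w.1) p).
have d2 := diff2D (diff2_snd p) (diff2_cst (- w.2) p).
by apply: diff2_eq (diff2D (diff2M d1 d1) (diff2M d2 d2)) _ _ => /=; ring.
Qed.

Definition smooth_inv (w : R * R) (t : R) (p : R * R) : R :=
  inv_cutoff (sqdist w p / t ^+ 2) / t ^+ 2.

(** The value no longer depends on [t], so the difference for two radii vanishes outside the larger
    disc. *)
Lemma smooth_inv_far (w p : R * R) (t : R) : 0 < t -> t ^+ 2 <= sqdist w p ->
  smooth_inv w t p = (sqdist w p * 2)^-1.
Proof.
move=> t0 h; have t20 : 0 < t ^+ 2 by rewrite exprn_gt0.
rewrite /smooth_inv inv_cutoff_ge1; last by rewrite ler_pdivlMr// mul1r.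
by field; rewrite !gt_eqF// (lt_le_trans t20).
Qed.

(** A radial function has its gradient parallel to [p - w]; [m] is the factor. The second equation
    evaluates the divergence of the field [smooth_inv w t p * (p - w)]. *)
Lemma smooth_inv_diff (w p : R * R) (t : R) : 0 < t -> exists m,
  diff2 (smooth_inv w t) p (m * (p.1 - w.1)) (m * (p.2 - w.2)) /\
  2 * smooth_inv w t p + m * sqdist w p = 2 * (bump w t p / t ^+ 2).
Proof.
move=> t0; have t20 : 0 < t ^+ 2 by rewrite exprn_gt0.
pose n := sqdist w p; pose l := inv_cutoff' (n / t ^+ 2) / (t ^+ 2 * t ^+ 2).
exists (l * 2); split.
  have := diff2_comp (h := fun v => inv_cutoff (v / t ^+ 2) / t ^+ 2) (l := l) _
    (sqdist_diff w p).
  (* After rescaling by [t ^+ 2], the quadratic remainder of [inv_cutoff] is at most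
     [(v - n) ^+ 2 / t ^+ 6], whence this radius. *)
  rewrite !mulrA; apply=> e e0; exists (e * (t ^+ 2 * t ^+ 2 * t ^+ 2)).
    by rewrite !mulr_gt0.
  move=> v vd.
  have -> : inv_cutoff (v / t ^+ 2) / t ^+ 2 - inv_cutoff (sqdist w p / t ^+ 2) / t ^+ 2 -
     l * (v - sqdist w p) = (inv_cutoff (v / t ^+ 2) - inv_cutoff (n / t ^+ 2) -
       inv_cutoff' (n / t ^+ 2) * (v / t ^+ 2 - n / t ^+ 2)) / t ^+ 2.
    by rewrite /l /n; field; rewrite gt_eqF.
  rewrite normrM (gtr0_norm (x := (t ^+ 2)^-1)) ?invr_gt0// ler_pdivrMr//.
  apply: le_trans (inv_cutoff_diff _ _) _.
  rewrite -mulrBl exprMn -real_normK ?num_real// expr2 -mulrA [e * _]mulrC -mulrA.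
  apply: ler_wpM2l => //; rewrite [X in _ * X]exprVn ler_pdivrMr ?exprn_gt0//.
  by apply/ltW; move: vd; rewrite -/n expr2 !mulrA.
rewrite /bump -inv_cutoff_euler /smooth_inv /l -/n.
by field; rewrite gt_eqF.
Qed.

Lemma diff2Z (k : R) (f : R * R -> R) p fx fy : diff2 f p fx fy ->
  diff2 (fun q => k * f q) p (k * fx) (k * fy).
Proof.
by move=> df; apply: diff2_eq (diff2M (diff2_cst k p) df) _ _; ring.
Qed.

Definition box (w : R * R) (t : R) := csquare (w.1 - t) (w.2 - t) (t + t).

Lemma bump_out (w p : R * R) (t : R) : 0 < t -> t ^+ 2 <= sqdist w p -> bump w t p = 0.
Proof.
move=> t0 h; rewrite /bump max_r// subr_le0 ler_pdivlMr ?exprn_gt0//.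
by rewrite mul1r.
Qed.

Lemma box_out (w p : R * R) (t : R) : 0 < t -> ~ box w t p -> t ^+ 2 <= sqdist w p.
Proof.
move=> t0 nb; rewrite leNgt; apply/negP => h; apply: nb.
have h1 : (p.1 - w.1) ^+ 2 < t ^+ 2.
  by apply: le_lt_trans h; rewrite lerDl sqr_ge0.
have h2 : (p.2 - w.2) ^+ 2 < t ^+ 2.
  by apply: le_lt_trans h; rewrite lerDr sqr_ge0.
move: h1 h2; rewrite -[(p.1 - _) ^+ 2]real_normK ?num_real//.
rewrite -[(p.2 - _) ^+ 2]real_normK ?num_real//.
rewrite !ltr_pXn2r ?nnegrE// ?(ltW t0)// !ltr_norml => /andP[? ?] /andP[? ?].
by rewrite /box /csquare /= !in_itv/=; split; lra.
Qed.

Lemma measurable_sqdist (w : R * R) : measurable_fun setT (sqdist w : T2 -> R).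
Proof.
rewrite /sqdist; apply: measurable_funD; apply: measurable_funX;
by apply: measurable_funB.
Qed.

Lemma measurable_bump (w : R * R) (t : R) : measurable_fun setT (bump w t : T2 -> R).
Proof.
apply: measurable_maxr => //; apply: measurable_funB => //.
by apply: measurable_funM => //; exact: measurable_sqdist.
Qed.

Lemma maxr0_lip (u v : R) : `|Num.max u 0 - Num.max v 0| <= `|u - v|.
Proof.
have := ler_norm (u - v); have := ler_norm (v - u); rewrite distrC.
move: `|u - v| => N h1 h2; rewrite ler_norml.
by case: (leP u 0) => hu; case: (leP v 0) => hv; apply/andP; split; lra.
Qed.

Lemma cont2_bump (w p : R * R) (t : R) : cont2 (bump w t) p.
Proof.
apply: (@cont2_lip _ (fun v => Num.max (1 - v) 0)).
  move=> u v; rewrite -[in X in _ <= X]normrN opprB.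
  by have -> : v - u = (1 - u) - (1 - v); [ring|exact: maxr0_lip].
apply: cont2M; last exact: cont2_cst.
exact: (diff2_cont2 (sqdist_diff w p)).
Qed.

Lemma int_support (f : R * R -> R) (D E : set (R * R)) : D `<=` E ->
  (forall p, E p -> ~ D p -> f p = 0) ->
  \int[mu2]_(p in E) f p = \int[mu2]_(p in D) f p.
Proof.
move=> DE f0; rewrite [LHS]Rintegral_mkcond [RHS]Rintegral_mkcond.
apply: eq_Rintegral => p _; rewrite /patch.
have [pD|npD] := pselect (D p); first by rewrite !mem_set//; exact: DE.
rewrite [p \in D]memNset//; have [pE|npE] := pselect (E p); last by rewrite memNset.
by rewrite mem_set// f0.
Qed.

(* Cauchy-Riemann equations, i.e. complex differentiability of [U + i V] at [p]. *)
Definition holo2 (U V : R * R -> R) (p : R * R) : Prop :=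
  exists a b, diff2 U p a (- b) /\ diff2 V p b a.

(* Green's formula for the field [(Re G, - Im G)], where [G] is the product of
   [U + i V] and [conj (z - w) * (smooth_inv w t z - smooth_inv w s z)]: it is
   continuous at [w] and vanishes outside the disc of radius [t]. *)
Lemma bump_scale (U V : R * R -> R) (w : R * R) (t s : R) : 0 < s -> s <= t ->
  measurable_fun setT (U : T2 -> R) ->
  (forall x y, w.1 - t <= x <= w.1 - t + (t + t) ->
     w.2 - t <= y <= w.2 - t + (t + t) -> holo2 U V (x, y)) ->
  \int[mu2]_(p in box w t)
    (U p * (2 * (bump w t p / t ^+ 2) + - 2 * (bump w s p / s ^+ 2))) = 0.
Proof.
move=> s0 st mU hUV; have t0 : 0 < t by exact: lt_le_trans st.
pose m q := smooth_inv w t q + - 1 * smooth_inv w s q.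
pose A q := m q * (U q * (q.1 + - w.1) + V q * (q.2 + - w.2)).
pose B q := m q * (U q * (q.2 + - w.2) + - 1 * (V q * (q.1 + - w.1))).
have m0 q : t ^+ 2 <= sqdist w q -> m q = 0.
  move=> h; rewrite /m !smooth_inv_far//; first by rewrite mulN1r subrr.
  by apply: le_trans h; apply: lerXn2r => //; rewrite nnegrE ltW.
(* On each side of the box one coordinate is at distance [t] from that of [w], so [m], and the field
   with it, vanishes there. *)
have edge (u v : R) : u ^+ 2 = t ^+ 2 -> t ^+ 2 <= u ^+ 2 + v ^+ 2 /\
    t ^+ 2 <= v ^+ 2 + u ^+ 2.
  by move=> ->; rewrite lerDl lerDr sqr_ge0.
have -> : (\int[mu2]_(p in box w t)
    (U p * (2 * (bump w t p / t ^+ 2) + - 2 * (bump w s p / s ^+ 2)))) =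
    flux A B (w.1 - t) (w.2 - t) (t + t).
  apply/esym/green_square; first by rewrite addr_gt0.
  - apply: measurable_funM => //.
    by apply: measurable_funD; apply: measurable_funM => //; apply: measurable_funM => //;
      exact: measurable_bump.
  - move=> x y xI yI; have [a [b [dU dV]]] := hUV _ _ xI yI.
    split.
      apply: cont2M; first exact: diff2_cont2 dU.
      by apply: cont2D; apply: cont2M; [exact: cont2_cst|
        apply: cont2M; [exact: cont2_bump|exact: cont2_cst]|exact: cont2_cst|
        apply: cont2M; [exact: cont2_bump|exact: cont2_cst]].
    have [mt [dt et]] := smooth_inv_diff w (x, y) t0.
    have [ms [ds es]] := smooth_inv_diff w (x, y) s0.
    have dm := diff2D dt (diff2Z (- 1) ds).
    have d1 := diff2D (diff2_fst (x, y)) (diff2_cst (- w.1) (x, y)).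
    have d2 := diff2D (diff2_snd (x, y)) (diff2_cst (- w.2) (x, y)).
    have dA := diff2M dm (diff2D (diff2M dU d1) (diff2M dV d2)).
    have dB := diff2M dm (diff2D (diff2M dU d2) (diff2Z (- 1) (diff2M dV d1))).
    (* The Cauchy-Riemann equations eliminate the derivatives of [U] and [V]: the divergence is [U]
       times that of [m q * (q - w)], given by [smooth_inv_diff]. *)
    do 4 eexists; split; [exact: dA|exact: dB|].
    have -> : - 2 * (bump w s (x, y) / s ^+ 2) = - (2 * (bump w s (x, y) / s ^+ 2)) by ring.
    by rewrite -et -es /sqdist /=; ring.
have a0 (f g : R -> R) (D : set R) : (forall v, f v = 0) ->
    \int[mu]_(v in D) f v = 0.
  move=> f0; rewrite (eq_Rintegral _ (g := cst 0)) => [|v _ /=]; last exact: f0.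
  by rewrite /Rintegral integral0.
rewrite /flux !a0 ?subrr ?addr0// => v; rewrite /A /B m0 ?mul0r// /sqdist /=.
- by apply: (edge _ _ _).2; ring.
- by apply: (edge _ _ _).2; ring.
- by apply: (edge _ _ _).1; ring.
- by apply: (edge _ _ _).1; ring.
Qed.

Lemma integrable_box (f : R * R -> R) (w : R * R) (t : R) : 0 < t ->
  measurable_fun setT (f : T2 -> R) ->
  (forall x y, w.1 - t <= x <= w.1 - t + (t + t) ->
     w.2 - t <= y <= w.2 - t + (t + t) -> cont2 f (x, y)) ->
  mu2.-integrable (box w t) (EFin \o f).
Proof.
move=> t0 mf cf; have tt0 : 0 < t + t by rewrite addr_gt0.
have [M fM] := cont2_bounded tt0 cf.
by apply: integrable_csquare fM => //; exact: ltW.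
Qed.

Lemma box_sub (w : R * R) (s t : R) : s <= t -> box w s `<=` box w t.
Proof.
move=> st p; rewrite /box /csquare /= !in_itv/= => -[/andP[? ?] /andP[? ?]].
by split; lra.
Qed.

Lemma box_dist (w p : R * R) (t : R) : box w t p ->
  `|p.1 - w.1| <= t /\ `|p.2 - w.2| <= t.
Proof.
rewrite /box /csquare /= !in_itv/= => -[/andP[? ?] /andP[? ?]].
by rewrite !ler_norml; split; lra.
Qed.

Lemma dist_box (w p : R * R) (t : R) :
  `|p.1 - w.1| < t -> `|p.2 - w.2| < t -> box w t p.
Proof.
rewrite !ltr_norml /box /csquare /= !in_itv/= => /andP[? ?] /andP[? ?].
by split; lra.
Qed.

Lemma box_translate (p q : R * R) (a s t : R) : `|q.1 - p.1| <= a ->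
  `|q.2 - p.2| <= a -> a + s <= t -> box q s `<=` box p t.
Proof.
rewrite !ler_norml => /andP[? ?] /andP[? ?] ? z.
rewrite /box /csquare /= !in_itv/= => -[/andP[? ?] /andP[? ?]].
by split; lra.
Qed.

Lemma bump_ge0 (w p : R * R) t : 0 <= bump w t p.
Proof. by rewrite /bump le_max lexx orbT. Qed.

Lemma sqdist_ge0 (w p : R * R) : 0 <= sqdist w p.
Proof. by rewrite addr_ge0 ?sqr_ge0. Qed.

Lemma bump_le1 (w p : R * R) t : bump w t p <= 1.
Proof.
by rewrite /bump ge_max ler01 andbT gerBl divr_ge0 ?sqdist_ge0// exprn_even_ge0.
Qed.

(** For [U - U w], [bump_scale] makes the integral against [bump w s], divided by [s ^+ 2],
    independent of [s]. It tends to [0] with [s] because [U] is continuous at [w], so it is [0] at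
    [s = t]. *)
Lemma mean_value (U V : R * R -> R) (w : R * R) (t : R) : 0 < t ->
  measurable_fun setT (U : T2 -> R) ->
  (forall x y, w.1 - t <= x <= w.1 - t + (t + t) ->
     w.2 - t <= y <= w.2 - t + (t + t) -> holo2 U V (x, y)) ->
  \int[mu2]_(p in box w t) (U p * bump w t p) =
  U w * \int[mu2]_(p in box w t) bump w t p.
Proof.
move=> t0 mU hUV; have mbox := measurable_csquare (w.1 - t) (w.2 - t) (t + t).
pose U0 q := U q + - U w.
have mU0 : measurable_fun setT (U0 : T2 -> R) by apply: measurable_funD.
have cU x y : w.1 - t <= x <= w.1 - t + (t + t) ->
     w.2 - t <= y <= w.2 - t + (t + t) -> cont2 U (x, y).
  by move=> hx hy; have [a [b [/diff2_cont2]]] := hUV _ _ hx hy.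
have cU0 x y : w.1 - t <= x <= w.1 - t + (t + t) ->
     w.2 - t <= y <= w.2 - t + (t + t) -> cont2 U0 (x, y).
  by move=> hx hy; apply: cont2D; [exact: cU|exact: cont2_cst].
have hU0 x y : w.1 - t <= x <= w.1 - t + (t + t) ->
     w.2 - t <= y <= w.2 - t + (t + t) -> holo2 U0 V (x, y).
  move=> hx hy; have [a [b [dU dV]]] := hUV _ _ hx hy; exists a, b; split=> //.
  by apply: diff2_eq (diff2D dU (diff2_cst _ _)) _ _; rewrite addr0.
have mUb s : measurable_fun setT ((fun p => U0 p * bump w s p) : T2 -> R).
  by apply: measurable_funM => //; exact: measurable_bump.
have iUb s : mu2.-integrable (box w t) (EFin \o (fun p => U0 p * bump w s p)).
  by apply: integrable_box => // x y hx hy; apply: cont2M;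
    [exact: cU0|exact: cont2_bump].
have ib s : mu2.-integrable (box w t) (EFin \o bump w s).
  apply: integrable_box => //; first exact: measurable_bump.
  by move=> x y _ _; exact: cont2_bump.
pose K s := \int[mu2]_(p in box w t) (U0 p * bump w s p).
have iUbZ s k : mu2.-integrable (box w t) (EFin \o (fun p => k * (U0 p * bump w s p))).
  exact: (integrableZl mbox k (iUb s)).
have KE s : 0 < s -> s <= t -> K t / t ^+ 2 = K s / s ^+ 2.
  move=> s0 st; have := bump_scale s0 st mU0 hU0.
  have -> : \int[mu2]_(p in box w t)
      (U0 p * (2 * (bump w t p / t ^+ 2) + - 2 * (bump w s p / s ^+ 2))) =
    \int[mu2]_(p in box w t) ((2 / t ^+ 2) * (U0 p * bump w t p) +
      (- 2 / s ^+ 2) * (U0 p * bump w s p)) by apply: eq_Rintegral => p _; ring.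
  rewrite RintegralD// !RintegralZl// -/(K s) -/(K t).
  by move: (K s) (K t) => u v h; lra.
suff Kt0 : K t = 0.
  have -> : \int[mu2]_(p in box w t) (U p * bump w t p) =
      \int[mu2]_(p in box w t) (U0 p * bump w t p + U w * bump w t p).
    by apply: eq_Rintegral => p _; rewrite /U0; ring.
  rewrite RintegralD//; last exact: (integrableZl mbox (U w) (ib t)).
  by rewrite RintegralZl// -/(K t) Kt0 add0r.
have t20 : 0 < t ^+ 2 by rewrite exprn_gt0.
have wI1 : w.1 - t <= w.1 <= w.1 - t + (t + t) by lra.
have wI2 : w.2 - t <= w.2 <= w.2 - t + (t + t) by lra.
have cw : cont2 U0 w by rewrite (surjective_pairing w); exact: cU0.
(* [U0] is at most [e] on a small box of half side [s], whose area is [4 * s ^+ 2]. *)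
have small e : 0 < e -> `|K t / t ^+ 2| <= 4 * e.
  move=> e0; have [d d0 dP] := cw _ e0.
  pose s : R := Num.min (d / 2) t.
  have s0 : 0 < s by rewrite lt_min t0 divr_gt0.
  have st : s <= t by rewrite ge_min lexx orbT.
  have sd : s < d by rewrite gt_min ltr_pdivrMr// ltr_pMr// ltr1n.
  have s20 : 0 < s ^+ 2 by rewrite exprn_gt0.
  rewrite (KE s)//.
  have Ks : `|K s - 0 * (s + s) ^+ 2| <= e * (s + s) ^+ 2.
    rewrite /K (int_support (box_sub st)); last first.
      by move=> p _ /(box_out s0) /(bump_out s0) ->; rewrite mulr0.
    apply: int_csquare_approx; first by rewrite addr_ge0 ?ltW.
      by apply: integrableS (iUb s) => //; [exact: measurable_csquare|exact: box_sub].
    move=> p pb; rewrite subr0 normrM (ger0_norm (bump_ge0 _ _ _)).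
    have [p1 p2] := box_dist pb.
    have := dP _ _ (le_lt_trans p1 sd) (le_lt_trans p2 sd).
    rewrite !subrKC -surjective_pairing => Up.
    rewrite -[e]mulr1; apply: ler_pM => //; [exact: bump_ge0| |exact: bump_le1].
    by move: Up; rewrite /U0 subrr subr0.
  move: Ks; rewrite mul0r subr0 normrM (gtr0_norm (x := (s ^+ 2)^-1)) ?invr_gt0//.
  by rewrite ler_pdivrMr// => /le_trans; apply; rewrite le_eqVlt; apply/orP; left; apply/eqP; ring.
apply/eqP; have : K t / t ^+ 2 == 0.
  rewrite -normr_le0; apply/ler_addgt0Pl => e e0; rewrite addr0.
  by have := small (e / 4) (divr_gt0 e0 (ltr0n _ 4)); rewrite mulrCA divff// mulr1.
by rewrite mulf_eq0 invr_eq0 (gt_eqF t20) orbF.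
Qed.
End mean_value.

(** * From complex differentiability to measurable, real-differentiable parts *)

Section plane_measurability.
Variable R : realType.
Notation T2 := (measurableTypeR R * measurableTypeR R)%type.

(** The preimage of an open half-line is open, hence the union of the countably many squares with
    rational corner and side that it contains. *)
Lemma cont2_measurable (f : R * R -> R) : (forall p, cont2 f p) ->
  measurable_fun setT (f : T2 -> R).
Proof.
move=> cf; apply: (measurability _ (RGenInftyO.measurableE R)) => _ [_ [a ->] <-].
rewrite setTI.
set S : set T2 := f @^-1` _.
pose F (q : rat * rat * rat) : set T2 :=
  let Q := csquare (ratr q.1.1) (ratr q.1.2) (ratr q.2) in
  if pselect (Q `<=` S) then Q else set0.
rewrite (_ : S = \bigcup_q F q); last first.
  apply/seteqP; split; last first.
    by move=> p [q _]; rewrite /F; case: pselect => // h; exact: h.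
  move=> p Sp; have fpa : f p < a by move: Sp; rewrite /S/= in_itv/=.
  have e0 : 0 < (a - f p) / 2 by rewrite divr_gt0// subr_gt0.
  have [d d0 dP] := cf p _ e0.
  have [r] := @rat_in_itvoo R 0 d d0; rewrite in_itv/= => /andP[r0 rd].
  have h1 : p.1 - ratr r < p.1 by rewrite ltrBlDr ltrDl.
  have h2 : p.2 - ratr r < p.2 by rewrite ltrBlDr ltrDl.
  have [x] := rat_in_itvoo h1; rewrite in_itv/= => /andP[x1 x2].
  have [y] := rat_in_itvoo h2; rewrite in_itv/= => /andP[y1 y2].
  have QS : csquare (ratr x) (ratr y) (ratr r) `<=` S.
    move=> [u v]; rewrite /csquare/= !in_itv/= => -[/andP[u1 u2] /andP[v1 v2]].
    have := dP (u - p.1) (v - p.2); rewrite !subrKC ler_norml => H.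
    have /andP[_ h] : - ((a - f p) / 2) <= f (u, v) - f p <= (a - f p) / 2.
      by apply: H; rewrite ltr_norml; apply/andP; split; lra.
    by rewrite /S/= in_itv/=; lra.
  have FE : F (x, y, r) = csquare (ratr x) (ratr y) (ratr r).
    by rewrite /F; case: pselect.
  exists (x, y, r) => //; rewrite FE.
  by rewrite /csquare/= !in_itv/=; split; lra.
apply: countable_bigcupT_measurable => // q; rewrite /F; case: pselect => /= [_|//].
exact: measurable_csquare.
Qed.

Lemma cont2_comp (h : R -> R) (f : R * R -> R) p : {for f p, continuous h} ->
  cont2 f p -> cont2 (fun q => h (f q)) p.
Proof.
move=> /cvgrPdist_le ch cf e e0; have /nbhs_ballP[d /= d0 dP] := ch e e0.
have d20 : 0 < d / 2 by rewrite divr_gt0.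
have [d' d'0 dP'] := cf _ d20; exists d' => // x y xd yd.
rewrite distrC; apply: dP; rewrite /ball/= distrC.
by apply: le_lt_trans (dP' _ _ xd yd) _; rewrite ltr_pdivrMr// ltr_pMr// ltr1n.
Qed.

End plane_measurability.

Section complex_bridge.
Variable R : realType.

Definition re_part (F : R[i] -> R[i]) (p : R * R) : R := complex.Re (F (p.1 +i* p.2)).
Definition im_part (F : R[i] -> R[i]) (p : R * R) : R := complex.Im (F (p.1 +i* p.2)).

Lemma normc_leD (x y : R) : `|x +i* y| <= (`|x| + `|y|)%:C.
Proof.
rewrite normc_def/= lecR -(@ler_pXn2r _ 2)// ?nnegrE ?addr_ge0// ?sqrtr_ge0//.
rewrite sqr_sqrtr ?addr_ge0 ?sqr_ge0// sqrrD !real_normK ?num_real//.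
by rewrite lerD2r lerDl mulrn_wge0// mulr_ge0.
Qed.

Lemma normc_ge_parts (z : R[i]) (e : R) : `|z| <= e%:C ->
  `|complex.Re z| <= e /\ `|complex.Im z| <= e.
Proof.
case: z => x y; rewrite normc_def/= lecR => h.
split; apply: le_trans h; rewrite -(@ler_pXn2r _ 2)// ?nnegrE ?sqrtr_ge0//;
  by rewrite sqr_sqrtr ?addr_ge0 ?sqr_ge0// real_normK ?num_real// ?lerDl ?lerDr ?sqr_ge0.
Qed.

(** With derivative [a + i b], the real and imaginary parts of [(x + i y) * (a + i b)] are the two
    linear parts required by [holo2]. *)
Lemma derivable_holo2 (F : R[i] -> R[i]) (p : R * R) :
  derivable (F : R[i]^o -> R[i]^o) (p.1 +i* p.2) 1 ->
  holo2 (re_part F) (im_part F) p.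
Proof.
set z := p.1 +i* p.2 => /cvg_ex[/= d /(@cvgrPdist_le _ R[i]^o) dP].
have key (e : R) : 0 < e -> exists2 dl : R, 0 < dl &
    forall x y : R, `|x| < dl -> `|y| < dl ->
    `|F (z + (x +i* y)) - F z - (x +i* y) * d| <= (e * (`|x| + `|y|))%:C.
  move=> e0; have := dP e%:C.
  rewrite ltcR => /(_ e0); rewrite /dnbhs/= near_withinE.
  (* The radius of a ball in [R[i]] is a complex number; its positivity forces the imaginary part
     [di] to be [0]. *)
  move=> /nbhs_ballP[dc /=]; case: dc => dr di.
  rewrite ltcE/= => /andP[/eqP di0 dr0]; rewrite di0 => H.
  exists (dr / 2); first by rewrite divr_gt0.
  move=> x y xd yd; set h := x +i* y.
  (* The limit defining the derivative is punctured, so [h = 0] is treated apart. *)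
  have [->|h0] := eqVneq h 0.
    by rewrite addr0 mul0r subrr subr0 normr0 lecR mulr_ge0 ?addr_ge0// ltW.
  have hn : `|h| <= (`|x| + `|y|)%:C by exact: normc_leD.
  have := H h _ h0; rewrite /ball/= sub0r normrN => H'.
  have {}H' : `|d - h^-1 *: (F (h *: 1 + z) - F z)| <= e%:C.
    apply: H'; apply: le_lt_trans hn _; rewrite ltcE/= eqxx/=.
    by rewrite (splitr dr) ltrD.
  have -> : F (z + h) - F z - h * d = - h * (d - h^-1 *: (F (h *: 1 + z) - F z)).
    rewrite /GRing.scale/= mulr1 [h + z]addrC mulrBr !mulNr mulrA divff// mul1r.
    by rewrite opprK [RHS]addrC.
  rewrite normrM normrN mulrC rmorphM/=.
  by apply: ler_pM.
case: d key {dP} => a b key; exists a, b; split=> e e0; have [dl dl0 H] := key _ e0;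
  exists dl => // x y xd yd; have [h1 h2] := normc_ge_parts (H _ _ xd yd).
  move: h1; rewrite /re_part; set A := F _; set B := F _.
  have -> : A = F ((p.1 + x) +i* (p.2 + y)) by [].
  move: (F _) B => {A} [a1 a2] [b1 b2] /=.
  by rewrite mulNr [a * x]mulrC [b * y]mulrC.
move: h2; rewrite /im_part; set A := F _; set B := F _.
have -> : A = F ((p.1 + x) +i* (p.2 + y)) by [].
move: (F _) B => {A} [a1 a2] [b1 b2] /=.
by rewrite [b * x]mulrC [a * y]mulrC.
Qed.
End complex_bridge.

(** * The local estimate *)

Lemma cauchy_schwarz2 (R : rcfType) (a b x y : R) :
  `|a * x + b * y| <= Num.sqrt (a ^+ 2 + b ^+ 2) * Num.sqrt (x ^+ 2 + y ^+ 2).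
Proof.
rewrite -sqrtrM ?addr_ge0 ?sqr_ge0// -sqrtr_sqr; apply: ler_wsqrtr.
have -> : (a ^+ 2 + b ^+ 2) * (x ^+ 2 + y ^+ 2) =
  (a * x + b * y) ^+ 2 + (a * y - b * x) ^+ 2 by ring.
by rewrite lerDl sqr_ge0.
Qed.

(* [x + i y] and [a + i b] stand for [F p] and [F w]; the coefficients of
   [a * x + b * y] and of [(a * x + b * y) / (x ^+ 2 + y ^+ 2)] are such that the right-hand
   side reduces to [5 * (rho - 1) ^+ 2] once both are replaced by their means. *)
Lemma nonvanishing_ineq (R : rcfType) (a b x y : R) :
  let r := Num.sqrt (a ^+ 2 + b ^+ 2) in let rho := Num.sqrt (x ^+ 2 + y ^+ 2) in
  2^-1 <= r -> 2^-1 <= rho ->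
  (x - a) ^+ 2 + (y - b) ^+ 2 <= 5 * (rho - 1) ^+ 2 + - 2 * (a * x + b * y) +
    ((2 * r ^+ 2 + 2 / r) + - (2 / r) * ((a * x + b * y) / (x ^+ 2 + y ^+ 2))).
Proof.
move=> r rho hr hrho.
have r2 : r ^+ 2 = a ^+ 2 + b ^+ 2 by rewrite sqr_sqrtr// addr_ge0 ?sqr_ge0.
have rho2 : rho ^+ 2 = x ^+ 2 + y ^+ 2 by rewrite sqr_sqrtr// addr_ge0 ?sqr_ge0.
have := cauchy_schwarz2 a b x y; rewrite -/r -/rho -rho2.
have -> : (x - a) ^+ 2 + (y - b) ^+ 2 = rho ^+ 2 - 2 * (a * x + b * y) + r ^+ 2.
  by rewrite r2 rho2; ring.
move: (a * x + b * y) r rho hr hrho {r2 rho2} => H r rho hr hrho.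
rewrite ler_norml => /andP[_ h].
have r0 : 0 < r by lra.
have rho0 : 0 < rho by lra.
have k1 : 2 / r * (H / rho ^+ 2) <= 2 / rho.
  have -> : 2 / r * (H / rho ^+ 2) = 2 / (r * rho ^+ 2) * H by field; rewrite !gt_eqF.
  have -> : 2 / rho = 2 / (r * rho ^+ 2) * (r * rho) by field; rewrite !gt_eqF.
  by apply: ler_wpM2l => //; rewrite divr_ge0// mulr_ge0 ?exprn_ge0// ltW.
(* Expansion of [1 / rho] at [1]; [2^-1 <= rho] controls the remainder. *)
have k2 : rho - 2 + rho^-1 <= 2 * (rho - 1) ^+ 2.
  have -> : rho - 2 + rho^-1 = (rho - 1) ^+ 2 * rho^-1 by field; rewrite gt_eqF.
  rewrite mulrC; apply: ler_wpM2r; first exact: sqr_ge0.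
  by rewrite invf_ple ?posrE.
(* Arithmetic-geometric mean inequality for [r ^+ 2], [1 / r], [1 / r]. *)
have k3 : 3 <= r ^+ 2 + 2 / r.
  have -> : r ^+ 2 + 2 / r = 3 + (r - 1) ^+ 2 * (r + 2) / r by field; rewrite gt_eqF.
  rewrite lerDl; apply: divr_ge0; last exact: ltW.
  by apply: mulr_ge0; [exact: sqr_ge0|lra].
have k4 : rho ^+ 2 = (rho - 1) ^+ 2 + 2 * rho - 1 by ring.
move: k1 k4; rewrite [- (2 / r) * _]mulNr.
move: (2 / r * (H / rho ^+ 2)) (rho ^+ 2) ((rho - 1) ^+ 2) k2 => z rr dd k2 k1 k4.
lra.
Qed.

Lemma le_two_add_sqr (K : realFieldType) (x : K) : x <= 2 + (x - 1) ^+ 2.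
Proof. by have := sqr_ge0 (x - 1 - 2^-1); nra. Qed.

(** In the application [r] is [|F q|], [h] is the real part of [conj (F q) * F p], and [np], [nq]
    are the masses of the bumps at [p] and [q]. Dividing by [r] leaves
    [r * nq <= nq / 2 + 410 * d * t ^+ 2], and [t ^+ 2 <= 2 * nq] turns the error into
    [820 * d * nq]. *)
Lemma small_modulus_arith (K : realFieldType) (t d r h np nq : K) :
  0 < t -> 0 <= d -> 820 * d <= 4^-1 -> 0 <= r -> 0 <= np -> 2^-1 * t ^+ 2 <= nq ->
  r ^+ 2 * nq - h * np <= 10 * d * r * (33 * t ^+ 2) ->
  np - nq <= 160 * d * t ^+ 2 -> h <= r * 2^-1 -> r <= 3 / 4.
Proof.
move=> t0 d0 dsmall; rewrite le_eqVlt => /predU1P[<-|r0]; first by lra.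
move=> np0 nq_ge D1 D2 hr.
have hn : h * np <= r * 2^-1 * (nq + 160 * d * t ^+ 2).
  apply: le_trans (ler_wpM2r np0 hr) _; apply: ler_wpM2l; last by lra.
  by rewrite mulr_ge0// ltW.
have nq0 : 0 < nq by apply: lt_le_trans nq_ge; rewrite mulr_gt0 ?exprn_gt0.
have dn : d * t ^+ 2 <= 2 * d * nq.
  have -> : 2 * d * nq = d * (2 * nq) by ring.
  apply: ler_wpM2l => //; lra.
have E1 : r * nq <= 2^-1 * (nq + 160 * d * t ^+ 2) + 10 * d * (33 * t ^+ 2).
  rewrite -(ler_pM2l r0); lra.
rewrite -(ler_pM2r nq0).
have dn2 : 820 * d * nq <= 4^-1 * nq by apply: ler_wpM2r => //; exact: ltW.
lra.
Qed.

(** Cauchy-Riemann equations of [(a + i b) / (u + i v)] when the denominator has derivative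
    [c + i d], in the shape produced by [diff2M] and [diff2_comp]. *)
Lemma inv_cauchy_riemann (K : fieldType) (a b c d u v : K) :
  let n := u ^+ 2 + v ^+ 2 in n != 0 ->
  (a * - d + b * c) / n + (a * u + b * v) *
    (- n ^- 2 * (- d * u + u * - d + (c * v + v * c))) =
  - ((b * c + - a * d) / n + (b * u + - a * v) *
    (- n ^- 2 * (c * u + u * c + (d * v + v * d)))) /\
  (b * - d + - a * c) / n + (b * u + - a * v) *
    (- n ^- 2 * (- d * u + u * - d + (c * v + v * c))) =
  (a * c + b * d) / n + (a * u + b * v) *
    (- n ^- 2 * (c * u + u * c + (d * v + v * d))).
Proof. by rewrite /= => n0; split; field. Qed.

Section local_oscillation.
Variable R : realType.
Notation mu := (@lebesgue_measure R).
Notation mu2 := (mu \x mu)%E.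
Notation T2 := (measurableTypeR R * measurableTypeR R)%type.

Lemma le_Rintegral_subset (f : R * R -> R) (A B : set (R * R)) :
  measurable (A : set T2) -> measurable (B : set T2) -> A `<=` B ->
  mu2.-integrable B (EFin \o f) -> (forall p, 0 <= f p) ->
  \int[mu2]_(p in A) f p <= \int[mu2]_(p in B) f p.
Proof.
move=> mA mB AB fB f0; have fA := integrableS mB mA AB fB.
rewrite /Rintegral fine_le//; [exact: integrable_fin_num|exact: integrable_fin_num|].
apply: ge0_subset_integral => //; first exact: (measurable_int mu2).
by move=> p _; rewrite lee_fin.
Qed.

Lemma bump_half (w p : R * R) (t : R) : 0 < t -> box w (t / 2) p -> 2^-1 <= bump w t p.
Proof.
move=> t0 /box_dist[h1 h2]; rewrite /bump le_max; apply/orP; left.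
have : sqdist w p / t ^+ 2 <= 2^-1.
  rewrite ler_pdivrMr ?exprn_gt0// /sqdist -(real_normK (num_real (_ - w.1))).
  rewrite -(real_normK (num_real (_ - w.2))).
  have t20 : 0 <= t / 2 by rewrite divr_ge0// ltW.
  have k1 : `|p.1 - w.1| ^+ 2 <= (t / 2) ^+ 2 by apply: lerXn2r; rewrite ?nnegrE.
  have k2 : `|p.2 - w.2| ^+ 2 <= (t / 2) ^+ 2 by apply: lerXn2r; rewrite ?nnegrE.
  move: k1 k2; rewrite exprMn => ? ?; lra.
lra.
Qed.

(** Each coordinate contributes [5 * d], from [|a * (2 * b - a)| <= d * t * (4 * t + t)]. *)
Lemma bump_lip (p q z : R * R) (t d : R) : 0 < t -> 0 <= d <= 1 ->
  `|q.1 - p.1| <= d * t -> `|q.2 - p.2| <= d * t ->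
  `|z.1 - p.1| <= 2 * t -> `|z.2 - p.2| <= 2 * t ->
  `|bump q t z - bump p t z| <= 10 * d.
Proof.
move=> t0 /andP[d0 d1] q1 q2 z1 z2.
apply: le_trans (maxr0_lip _ _) _.
have -> : 1 - sqdist q z / t ^+ 2 - (1 - sqdist p z / t ^+ 2) =
  (sqdist p z - sqdist q z) / t ^+ 2 by ring.
rewrite normrM (gtr0_norm (x := _^-1)) ?invr_gt0 ?exprn_gt0// ler_pdivrMr ?exprn_gt0//.
have -> : sqdist p z - sqdist q z = (q.1 - p.1) * ((z.1 - p.1) + (z.1 - p.1) - (q.1 - p.1))
   + (q.2 - p.2) * ((z.2 - p.2) + (z.2 - p.2) - (q.2 - p.2)) by rewrite /sqdist; ring.
have coord (a b : R) : `|a| <= d * t -> `|b| <= 2 * t -> `|a * (b + b - a)| <= 5 * d * t ^+ 2.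
  move=> ha hb; rewrite normrM.
  have -> : 5 * d * t ^+ 2 = d * t * (5 * t) by ring.
  apply: ler_pM => //; apply: le_trans (ler_normB _ _) _.
  apply: le_trans (lerD (ler_normD _ _) ha) _.
  have : d * t <= t by rewrite ger_pMl.
  lra.
apply: le_trans (ler_normD _ _) _.
have := coord _ _ q1 z1; have := coord _ _ q2 z2; lra.
Qed.

Variables U V : R * R -> R.
Hypothesis holUV : forall p, holo2 U V p.

Let contU p : cont2 U p. Proof. by have [a [b [/diff2_cont2]]] := holUV p. Qed.
Let contV p : cont2 V p. Proof. by have [a [b [_ /diff2_cont2]]] := holUV p. Qed.

Let nrm2 p : R := U p ^+ 2 + V p ^+ 2.
Definition modulus p : R := Num.sqrt (U p ^+ 2 + V p ^+ 2).
Definition mod_dev p : R := (modulus p - 1) ^+ 2.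
Definition osc2 (w p : R * R) : R := (U p - U w) ^+ 2 + (V p - V w) ^+ 2.

Let cont_nrm2 p : cont2 nrm2 p.
Proof. by apply: cont2D; apply: cont2M. Qed.

Lemma cont2_modulus p : cont2 modulus p.
Proof. by apply: (@cont2_comp _ Num.sqrt nrm2) => //; exact: sqrt_continuous. Qed.

Lemma cont2_mod_dev p : cont2 mod_dev p.
Proof.
by apply: cont2M; apply: cont2D; [exact: cont2_modulus|exact: cont2_cst
  |exact: cont2_modulus|exact: cont2_cst].
Qed.

Lemma cont2_osc2 w p : cont2 (osc2 w) p.
Proof.
by apply: cont2D; apply: cont2M; apply: cont2D; (exact: contU||exact: contV||exact: cont2_cst).
Qed.

Lemma modulus_ge0 p : 0 <= modulus p. Proof. exact: sqrtr_ge0. Qed.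
Lemma mod_dev_ge0 p : 0 <= mod_dev p. Proof. exact: sqr_ge0. Qed.
Lemma osc2_ge0 w p : 0 <= osc2 w p. Proof. by rewrite addr_ge0 ?sqr_ge0. Qed.

Let modulusK p : modulus p ^+ 2 = nrm2 p.
Proof. by rewrite sqr_sqrtr// addr_ge0 ?sqr_ge0. Qed.

Let integrable_cont (f : R * R -> R) w t : 0 < t -> (forall p, cont2 f p) ->
  mu2.-integrable (box w t) (EFin \o f).
Proof. by move=> t0 cf; apply: integrable_box => //; exact: cont2_measurable. Qed.

(** Real part of [conj (a + i b) * F]; for [a + i b = F w] its value at [w] is [|F w|^2]. *)
Let lin (a b : R) p : R := a * U p + b * V p.

Let cont_lin a b p : cont2 (lin a b) p.
Proof. by apply: cont2D; apply: cont2M => //; exact: cont2_cst. Qed.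

Let mean_lin a b w t : 0 < t ->
  \int[mu2]_(p in box w t) (lin a b p * bump w t p) =
  lin a b w * \int[mu2]_(p in box w t) bump w t p.
Proof.
move=> t0; apply: (@mean_value _ _ (fun p => a * V p + - b * U p)) => //.
  exact: cont2_measurable.
move=> x y _ _; have [c [d [dU dV]]] := holUV (x, y).
exists (a * c + b * d), (a * d - b * c); split.
  by apply: diff2_eq (diff2D (diff2Z a dU) (diff2Z b dV)) _ _; ring.
by apply: diff2_eq (diff2D (diff2Z a dV) (diff2Z (- b) dU)) _ _; ring.
Qed.

Let inv_diff (v0 : R) : v0 != 0 -> forall e, 0 < e -> exists2 d, 0 < d &
  forall v, `|v - v0| < d -> `|v^-1 - v0^-1 - - (v0 ^+ 2)^-1 * (v - v0)| <= e * `|v - v0|.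
Proof.
move=> v00 e e0; have n0 : 0 < `|v0| by rewrite normr_gt0.
exists (Num.min (`|v0| / 2) (e * (`|v0| ^+ 3 / 2))).
  by rewrite lt_min divr_gt0//= mulr_gt0// divr_gt0// exprn_gt0.
move=> v; rewrite lt_min => /andP[h1 h2].
have hv : `|v0| / 2 <= `|v|.
  by have := lerB_dist v0 v; rewrite distrC; lra.
have vv0 : v != 0 by rewrite -normr_gt0; apply: lt_le_trans hv; rewrite divr_gt0.
have -> : v^-1 - v0^-1 - - (v0 ^+ 2)^-1 * (v - v0) = (v - v0) ^+ 2 / (v * v0 ^+ 2).
  by field; rewrite v00 vv0.
rewrite normrM normrX normfV normrM normrX expr2 -mulrA [e * _]mulrC.
apply: ler_wpM2l => //; rewrite ler_pdivrMr; last by rewrite mulr_gt0 ?normr_gt0 ?exprn_gt0.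
apply: le_trans (ltW h2) _; apply: ler_wpM2l; first exact: ltW.
have -> : `|v0| ^+ 3 / 2 = `|v0| / 2 * `|v0| ^+ 2 by ring.
by apply: ler_wpM2r => //; rewrite exprn_ge0.
Qed.

(** [lin a b p / nrm2 p] is the real part of [(a + i b) / F], holomorphic where [F] has no zero. *)
Let mean_inv a b w t : 0 < t ->
  (forall x y, w.1 - t <= x <= w.1 - t + (t + t) ->
     w.2 - t <= y <= w.2 - t + (t + t) -> nrm2 (x, y) != 0) ->
  mu2.-integrable (box w t) (EFin \o (fun p => lin a b p * (nrm2 p)^-1 * bump w t p)) /\
  \int[mu2]_(p in box w t) (lin a b p * (nrm2 p)^-1 * bump w t p) =
  lin a b w * (nrm2 w)^-1 * \int[mu2]_(p in box w t) bump w t p.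
Proof.
move=> t0 nz.
have mI : measurable_fun setT ((fun p => lin a b p * (nrm2 p)^-1) : T2 -> R).
  apply: measurable_funM; first exact: cont2_measurable.
  have mn : measurable_fun setT (nrm2 : T2 -> R) by exact: cont2_measurable.
  (* Inversion is treated as the real power of exponent [- 1] of a nonnegative number, real powers
     being measurable. *)
  rewrite (_ : (fun _ => _) = (fun v => v `^ (- 1)) \o nrm2).
    by apply: measurableT_comp => //; exact: measurable_powR.
  by apply/funext => p /=; rewrite powR_inv1// addr_ge0 ?sqr_ge0.
have hol x y : w.1 - t <= x <= w.1 - t + (t + t) ->
     w.2 - t <= y <= w.2 - t + (t + t) ->
     holo2 (fun p => lin a b p * (nrm2 p)^-1)
       (fun p => (b * U p + - a * V p) * (nrm2 p)^-1) (x, y).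
  move=> hx hy; have n0 := nz _ _ hx hy.
  have [c [d [dU dV]]] := holUV (x, y).
  have dn := diff2D (diff2M dU dU) (diff2M dV dV).
  have di := diff2_comp (@inv_diff _ n0) dn.
  have dA := diff2M (diff2D (diff2Z a dU) (diff2Z b dV)) di.
  have dB := diff2M (diff2D (diff2Z b dU) (diff2Z (- a) dV)) di.
  have [e1 e2] := @inv_cauchy_riemann _ a b c d (U (x, y)) (V (x, y)) n0.
  do 2 eexists; split; first exact: diff2_eq dA erefl e1.
  exact: diff2_eq dB erefl e2.
split; last exact: mean_value hol.
apply: integrable_box => //; first by apply: measurable_funM => //; exact: measurable_bump.
move=> x y hx hy; have [c [d [/diff2_cont2 cI _]]] := hol _ _ hx hy.
by apply: cont2M => //; exact: cont2_bump.
Qed.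

Let integrable_bump (f : R * R -> R) w t : 0 < t -> (forall p, cont2 f p) ->
  mu2.-integrable (box w t) (EFin \o (fun p => f p * bump w t p)).
Proof.
by move=> t0 cf; apply: integrable_cont => // p; apply: cont2M => //; exact: cont2_bump.
Qed.

Let mbox w t : measurable (box w t : set T2). Proof. exact: measurable_csquare. Qed.

Lemma Rintegral_lin4 (A : set T2) (c1 c2 c3 c4 : R) (f1 f2 f3 f4 : T2 -> R) :
  measurable A -> mu2.-integrable A (EFin \o f1) -> mu2.-integrable A (EFin \o f2) ->
  mu2.-integrable A (EFin \o f3) -> mu2.-integrable A (EFin \o f4) ->
  mu2.-integrable A (EFin \o (fun p => c1 * f1 p + c2 * f2 p + (c3 * f3 p + c4 * f4 p))) /\
  \int[mu2]_(p in A) (c1 * f1 p + c2 * f2 p + (c3 * f3 p + c4 * f4 p)) =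
  c1 * \int[mu2]_(p in A) f1 p + c2 * \int[mu2]_(p in A) f2 p +
  (c3 * \int[mu2]_(p in A) f3 p + c4 * \int[mu2]_(p in A) f4 p).
Proof.
move=> mA i1 i2 i3 i4.
have j1 := integrableZl mA c1 i1; have j2 := integrableZl mA c2 i2.
have j3 := integrableZl mA c3 i3; have j4 := integrableZl mA c4 i4.
have j12 := integrableD mA j1 j2; have j34 := integrableD mA j3 j4.
split; first exact: (integrableD mA j12 j34).
by rewrite (RintegralD mA j12 j34) (RintegralD mA j1 j2) (RintegralD mA j3 j4) !RintegralZl.
Qed.

Let lin_self w : lin (U w) (V w) w = nrm2 w.
Proof. by rewrite /lin /nrm2 !expr2. Qed.

Let lin_le a b p : `|lin a b p| <= Num.sqrt (a ^+ 2 + b ^+ 2) * modulus p.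
Proof. exact: cauchy_schwarz2. Qed.

(** By the mean value property, the variance of [F] is the mean of [|F|^2] minus [|F w|^2]. *)
Lemma osc_le_modulus w t : 0 < t ->
  \int[mu2]_(p in box w t) (osc2 w p * bump w t p) <=
  \int[mu2]_(p in box w t) (modulus p ^+ 2 * bump w t p).
Proof.
move=> t0; pose l := lin (U w) (V w).
have iU : mu2.-integrable (box w t) (EFin \o bump w t).
  by apply: integrable_cont => // p; exact: cont2_bump.
have iM : mu2.-integrable (box w t) (EFin \o (fun p => nrm2 p * bump w t p)).
  by apply: integrable_bump => // p; exact: cont_nrm2.
have iL : mu2.-integrable (box w t) (EFin \o (fun p => l p * bump w t p)).
  by apply: integrable_bump => // p; exact: cont_lin.
have [_ E] := Rintegral_lin4 1 (- 2) (nrm2 w) 0 (mbox w t) iM iL iU iU.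
have -> : \int[mu2]_(p in box w t) (osc2 w p * bump w t p) =
   \int[mu2]_(p in box w t) (1 * (nrm2 p * bump w t p) + - 2 * (l p * bump w t p) +
     (nrm2 w * bump w t p + 0 * bump w t p)).
  by apply: eq_Rintegral => p _; rewrite /osc2 /nrm2 /l /lin; ring.
rewrite E mean_lin// lin_self.
under [X in _ <= X]eq_Rintegral do rewrite modulusK.
have : 0 <= nrm2 w * \int[mu2]_(p in box w t) bump w t p.
  apply: mulr_ge0; first by rewrite addr_ge0 ?sqr_ge0.
  by apply: Rintegral_ge0 => p _; exact: bump_ge0.
lra.
Qed.

(* Mean value property of both [F] and [1 / F], integrated against
   [nonvanishing_ineq]. *)
Lemma osc_nonvanishing w t : 0 < t ->
  (forall x y, w.1 - t <= x <= w.1 - t + (t + t) ->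
     w.2 - t <= y <= w.2 - t + (t + t) -> 2^-1 <= modulus (x, y)) ->
  \int[mu2]_(p in box w t) (osc2 w p * bump w t p) <=
  5 * \int[mu2]_(p in box w t) (mod_dev p * bump w t p).
Proof.
move=> t0 nv; pose l := lin (U w) (V w).
have nz x y : w.1 - t <= x <= w.1 - t + (t + t) ->
     w.2 - t <= y <= w.2 - t + (t + t) -> nrm2 (x, y) != 0.
  move=> hx hy; rewrite -modulusK expf_neq0// gt_eqF//.
  by apply: lt_le_trans (nv _ _ hx hy).
have [iI EI] := mean_inv (U w) (V w) t0 nz.
have iU : mu2.-integrable (box w t) (EFin \o bump w t).
  by apply: integrable_cont => // p; exact: cont2_bump.
have iM : mu2.-integrable (box w t) (EFin \o (fun p => mod_dev p * bump w t p)).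
  by apply: integrable_bump => // p; exact: cont2_mod_dev.
have iL : mu2.-integrable (box w t) (EFin \o (fun p => l p * bump w t p)).
  by apply: integrable_bump => // p; exact: cont_lin.
have iO : mu2.-integrable (box w t) (EFin \o (fun p => osc2 w p * bump w t p)).
  by apply: integrable_bump => // p; exact: cont2_osc2.
have rw : 2^-1 <= modulus w.
  by rewrite (surjective_pairing w); apply: nv => /=; lra.
have [j E] := Rintegral_lin4 5 (- 2) (2 * modulus w ^+ 2 + 2 / modulus w)
  (- (2 / modulus w)) (mbox w t) iM iL iU iI.
apply: le_trans (le_Rintegral (mbox w t) iO j _) _.
  move=> [x y] pb /=.
  have h : 2^-1 <= modulus (x, y).
    move: pb; rewrite /box /csquare /= !in_itv/= => -[/andP[? ?] /andP[? ?]].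
    by apply: nv; lra.
  have := nonvanishing_ineq rw h; rewrite -/(modulus w) -/(modulus (x, y)) -/(nrm2 (x, y)).
  move=> /(ler_wpM2r (bump_ge0 w (x, y) t)) /le_trans; apply.
  rewrite /mod_dev /l /lin le_eqVlt; apply/orP; left; apply/eqP.
  by rewrite -/(modulus (x, y)); ring.
rewrite E EI mean_lin// lin_self modulusK divff; last first.
  by rewrite -modulusK expf_neq0// gt_eqF//; apply: lt_le_trans rw.
lra.
Qed.

Lemma int_box_cst (w : R * R) (t k : R) : 0 < t ->
  \int[mu2]_(p in box w t) k = k * (t + t) ^+ 2.
Proof.
move=> t0; rewrite Rintegral_cst//; congr (_ * _).
by rewrite [X in fine X]measure_csquare// addr_ge0// ltW.
Qed.

Let integrable_cst w t k : 0 < t -> mu2.-integrable (box w t) (EFin \o (fun=> k)).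
Proof. by move=> t0; apply: integrable_cont => // p; exact: cont2_cst. Qed.

Lemma int_bump_ge (w : R * R) (t : R) : 0 < t ->
  2^-1 * t ^+ 2 <= \int[mu2]_(p in box w t) bump w t p.
Proof.
move=> t0; have t20 : 0 < t / 2 by rewrite divr_gt0.
have iU : mu2.-integrable (box w t) (EFin \o bump w t).
  by apply: integrable_cont => // p; exact: cont2_bump.
have sub : box w (t / 2) `<=` box w t by apply: box_sub; lra.
apply: le_trans (le_Rintegral_subset (mbox w (t / 2)) (mbox w t) sub iU (bump_ge0 w ^~ t)).
have -> : 2^-1 * t ^+ 2 = \int[mu2]_(p in box w (t / 2)) (2^-1).
  by rewrite int_box_cst//; field.
apply: le_Rintegral => //; [exact: integrable_cst|exact: integrableS iU|].
by move=> p /(bump_half t0).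
Qed.

(* Mean values over close discs are close, hence [|F|] stays below [3 / 4] near a
   point where it is at most [1 / 2], unless [|F|] is far from 1 on average. *)
Lemma modulus_near_zero (p q : R * R) (t d : R) : 0 < t -> 0 <= d <= 1 ->
  820 * d <= 4^-1 ->
  `|q.1 - p.1| <= d * t -> `|q.2 - p.2| <= d * t -> modulus p <= 2^-1 ->
  \int[mu2]_(z in box p (2 * t)) mod_dev z <= t ^+ 2 ->
  modulus q <= 3 / 4.
Proof.
move=> t0 /andP[d0 d1] dsmall q1 q2 hp hS.
have t20 : 0 < 2 * t by lra.
have dt : d * t <= t by rewrite ger_pMl.
set E := box p (2 * t).
have mE : measurable (E : set T2) by exact: mbox.
have pE : box p t `<=` E by apply: box_sub; lra.
have qE : box q t `<=` E by apply: box_translate q1 q2 _; lra.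
have ic (f : R * R -> R) : (forall z, cont2 f z) -> mu2.-integrable E (EFin \o f).
  by move=> cf; exact: integrable_cont.
have cb c z : cont2 (bump c t) z by exact: cont2_bump.
(* [H] is the real part of [conj (F q) * F]: its mean around [q] is [|F q|^2], whereas its mean
   around [p] is at most [|F q| / 2]. *)
pose a := U q; pose b := V q; pose r := modulus q; pose H := lin a b.
have ext (f : R * R -> R) c : box c t `<=` E ->
    \int[mu2]_(z in E) (f z * bump c t z) = \int[mu2]_(z in box c t) (f z * bump c t z).
  move=> cE; apply: int_support => // z _ /(box_out t0) /(bump_out t0) ->.
  by rewrite mulr0.
have ext1 c : box c t `<=` E ->
    \int[mu2]_(z in E) bump c t z = \int[mu2]_(z in box c t) bump c t z.
  by move=> cE; apply: int_support => // z _ /(box_out t0) /(bump_out t0).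
pose Np := \int[mu2]_(z in E) bump p t z; pose Nq := \int[mu2]_(z in E) bump q t z.
have Nq_ge : 2^-1 * t ^+ 2 <= Nq by rewrite /Nq ext1//; exact: int_bump_ge.
have Np0 : 0 <= Np by apply: Rintegral_ge0 => z _; exact: bump_ge0.
have Hq : \int[mu2]_(z in E) (H z * bump q t z) = r ^+ 2 * Nq.
  by rewrite ext// mean_lin// /Nq ext1// lin_self modulusK.
have Hp : \int[mu2]_(z in E) (H z * bump p t z) = H p * Np.
  by rewrite ext// mean_lin// /Np ext1.
have diff z : E z -> `|bump q t z - bump p t z| <= 10 * d.
  by move=> /box_dist[z1 z2]; apply: bump_lip => //; rewrite d0.
have iHq : mu2.-integrable E (EFin \o (fun z => H z * bump q t z)).
  by apply: ic => z; apply: cont2M => //; exact: cont_lin.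
have iHp : mu2.-integrable E (EFin \o (fun z => H z * bump p t z)).
  by apply: ic => z; apply: cont2M => //; exact: cont_lin.
have im : mu2.-integrable E (EFin \o modulus) by apply: ic; exact: cont2_modulus.
have id_ : mu2.-integrable E (EFin \o mod_dev) by apply: ic; exact: cont2_mod_dev.
have icst k : mu2.-integrable E (EFin \o (fun=> k)) by exact: integrable_cst.
(* [E] has area [16 * t ^+ 2]: the constant [2] gives [32 * t ^+ 2], and the deviation at most one
   more [t ^+ 2]. *)
have intm : \int[mu2]_(z in E) modulus z <= 33 * t ^+ 2.
  have i2 := integrableD mE (icst 2) id_.
  apply: le_trans (le_Rintegral mE im i2 _) _.
    by move=> z _; exact: le_two_add_sqr.
  rewrite (RintegralD mE (icst 2) id_) int_box_cst//.
  by have -> : 33 * t ^+ 2 = 2 * (2 * t + 2 * t) ^+ 2 + t ^+ 2; [ring|rewrite lerD2l].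
have D1 : r ^+ 2 * Nq - H p * Np <= 10 * d * r * (33 * t ^+ 2).
  rewrite -Hq -Hp -(RintegralB mE iHq iHp).
  have iB := integrableB mE iHq iHp.
  have iZ := integrableZl mE (10 * d * r) im.
  apply: le_trans (le_Rintegral mE iB iZ _) _.
    move=> z Ez; rewrite -mulrBr; apply: le_trans (ler_norm _) _; rewrite normrM.
    have -> : 10 * d * r * modulus z = (r * modulus z) * (10 * d) by ring.
    by apply: ler_pM => //; [exact: lin_le|exact: diff].
  rewrite RintegralZl//; apply: ler_wpM2l => //.
  by rewrite mulr_ge0 ?modulus_ge0// mulr_ge0.
have D2 : Np - Nq <= 160 * d * t ^+ 2.
  have ip : mu2.-integrable E (EFin \o bump p t) by exact: ic.
  have iq : mu2.-integrable E (EFin \o bump q t) by exact: ic.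
  rewrite /Np /Nq -(RintegralB mE ip iq).
  apply: le_trans (le_Rintegral mE (integrableB mE ip iq) (icst (10 * d)) _) _.
    by move=> z Ez; apply: le_trans (ler_norm _) _; rewrite distrC; exact: diff.
  rewrite int_box_cst// le_eqVlt; apply/orP; left; apply/eqP; ring.
have Hpr : H p <= r * 2^-1.
  apply: le_trans (ler_norm _) _; apply: le_trans (lin_le _ _ _) _.
  by apply: ler_wpM2l => //; exact: sqrtr_ge0.
exact: (small_modulus_arith t0 d0 dsmall (modulus_ge0 q) Np0 Nq_ge D1 D2 Hpr).
Qed.

(** If the deviation exceeds [t ^+ 2] on the large square, [d <= 1] is enough. Otherwise
    [|F| <= 3 / 4] on the square of half side [d * t] around [p], where the deviation is at least
    [1 / 16] and the area is [4 * (d * t) ^+ 2]. *)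
Lemma osc_vanishing (w p : R * R) (t d : R) : 0 < t -> 0 < d <= 1 -> 820 * d <= 4^-1 ->
  `|p.1 - w.1| <= t -> `|p.2 - w.2| <= t -> modulus p <= 2^-1 ->
  (d * t) ^+ 2 <= 4 * \int[mu2]_(z in box w (4 * t)) mod_dev z.
Proof.
move=> t0 /andP[d0 d1] dsmall p1 p2 hp.
have t40 : 0 < 4 * t by lra.
have dt0 : 0 < d * t by rewrite mulr_gt0.
have dt : d * t <= t by rewrite ger_pMl.
have i4 : mu2.-integrable (box w (4 * t)) (EFin \o mod_dev).
  by apply: integrable_cont => // z; exact: cont2_mod_dev.
have sub s : s <= 2 * t -> box p s `<=` box w (4 * t).
  by move=> st; apply: box_translate p1 p2 _; lra.
set S := \int[mu2]_(z in box w (4 * t)) mod_dev z.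
have S_ge s : s <= 2 * t -> \int[mu2]_(z in box p s) mod_dev z <= S.
  by move=> st; apply: le_Rintegral_subset => //; [exact: sub|exact: mod_dev_ge0].
have [hS|hS] := leP S (t ^+ 2); last first.
  have : (d * t) ^+ 2 <= t ^+ 2 by apply: lerXn2r => //; rewrite nnegrE; exact: ltW.
  have := sqr_ge0 t; lra.
have dt2 : d * t <= 2 * t by lra.
apply: le_trans (_ : 4 * \int[mu2]_(z in box p (d * t)) mod_dev z <= _); last first.
  by apply: ler_wpM2l => //; exact: S_ge.
have -> : (d * t) ^+ 2 = 4 * \int[mu2]_(z in box p (d * t)) (16^-1).
  by rewrite int_box_cst//; field.
apply: ler_wpM2l => //; apply: le_Rintegral => //; [exact: integrable_cst| |].
  by apply: integrableS i4 => //; exact: sub.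
move=> q /box_dist[q1 q2].
have h : modulus q <= 3 / 4.
  apply: (modulus_near_zero (t := t) (d := d)) hp _ => //; first by rewrite (ltW d0).
  exact: le_trans (S_ge _ (lexx _)) hS.
rewrite /mod_dev; have := modulus_ge0 q; nra.
Qed.

(** Let [S] be the integral on the right. The outer [2] undoes [bump >= 1 / 2] on the half square.
    If [|F| >= 1 / 2] on the square of half side [t], the bound [5 * S] holds; otherwise
    [|F|^2 <= 2 + 2 * (|F| - 1)^2] gives [8 * t ^+ 2 + 2 * S], and [osc_vanishing] gives
    [t ^+ 2 <= 4 / d ^+ 2 * S]. The factor [7] covers both cases. *)
Lemma local_oscillation (w : R * R) (t d : R) : 0 < t -> 0 < d <= 1 ->
  820 * d <= 4^-1 ->
  \int[mu2]_(p in box w (t / 2)) osc2 w p <=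
  2 * (7 + 8 * (4 / d ^+ 2)) * \int[mu2]_(p in box w (4 * t)) mod_dev p.
Proof.
move=> t0 d01 dsmall; have t40 : 0 < 4 * t by lra.
have d0 : 0 < d by case/andP: d01.
have d20 : 0 < d ^+ 2 by rewrite exprn_gt0.
have K0 : 0 <= 4 / d ^+ 2 by rewrite divr_ge0// ltW.
have t20 : 0 < t / 2 by lra.
have i4 : mu2.-integrable (box w (4 * t)) (EFin \o mod_dev).
  by apply: integrable_cont => // z; exact: cont2_mod_dev.
have sub : box w t `<=` box w (4 * t) by apply: box_sub; lra.
have sub2 : box w (t / 2) `<=` box w t by apply: box_sub; lra.
have i1 : mu2.-integrable (box w t) (EFin \o mod_dev) by exact: integrableS i4.
set S := \int[mu2]_(z in box w (4 * t)) mod_dev z.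
have S0 : 0 <= S by apply: Rintegral_ge0 => z _; exact: mod_dev_ge0.
have KS : 0 <= 4 / d ^+ 2 * S by exact: mulr_ge0.
have KE : (7 + 8 * (4 / d ^+ 2)) * S = 7 * S + 8 * (4 / d ^+ 2 * S) by ring.
have S1 : \int[mu2]_(z in box w t) mod_dev z <= S.
  by apply: le_Rintegral_subset => //; exact: mod_dev_ge0.
have iO : mu2.-integrable (box w t) (EFin \o (fun p => osc2 w p * bump w t p)).
  by apply: integrable_bump => // z; exact: cont2_osc2.
have iO2 : mu2.-integrable (box w (t / 2)) (EFin \o (fun p => osc2 w p * bump w t p)).
  exact: integrableS iO.
have step : \int[mu2]_(p in box w (t / 2)) osc2 w p <=
    2 * \int[mu2]_(p in box w t) (osc2 w p * bump w t p).
  apply: le_trans (_ : 2 * \int[mu2]_(p in box w (t / 2)) (osc2 w p * bump w t p) <= _).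
    rewrite -RintegralZl//; apply: le_Rintegral => //.
    - by apply: integrable_cont => // z; exact: cont2_osc2.
    - exact: (integrableZl (mbox w (t / 2)) 2 iO2).
    - move=> p /(bump_half t0) hb; rewrite mulrCA -[X in X <= _]mulr1.
      by apply: ler_wpM2l; [exact: osc2_ge0|lra].
  apply: ler_wpM2l => //; apply: le_Rintegral_subset => // p.
  by rewrite mulr_ge0 ?osc2_ge0 ?bump_ge0.
apply: le_trans step _; rewrite -mulrA; apply: ler_wpM2l => //.
have [nv|/existsNP[x /existsNP[y /not_implyP[hx /not_implyP[hy /negP]]]]] :=
    pselect (forall x y, w.1 - t <= x <= w.1 - t + (t + t) ->
     w.2 - t <= y <= w.2 - t + (t + t) -> 2^-1 <= modulus (x, y)).
  apply: le_trans (osc_nonvanishing t0 nv) _.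
  have : \int[mu2]_(p in box w t) (mod_dev p * bump w t p) <= S.
    apply: le_trans S1; apply: le_Rintegral => //.
      by apply: integrable_bump => // z; exact: cont2_mod_dev.
    move=> p _; rewrite -[X in _ <= X]mulr1; apply: ler_wpM2l; first exact: mod_dev_ge0.
    exact: bump_le1.
  by rewrite KE; move: (4 / d ^+ 2 * S) KS => k; lra.
rewrite -ltNge => /ltW hp.
have tS : t ^+ 2 <= 4 / d ^+ 2 * S.
  have : (d * t) ^+ 2 <= 4 * S.
    by apply: (osc_vanishing (p := (x, y))) => //=; rewrite ler_norml; lra.
  by rewrite exprMn mulrC -ler_pdivlMr// mulrAC.
apply: le_trans (osc_le_modulus w t0) _.
have ic2 := integrable_cst w 2 t0.
have i12 := integrableD (mbox w t) ic2 (integrableZl (mbox w t) 2 i1).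
have iM : mu2.-integrable (box w t) (EFin \o (fun p => modulus p ^+ 2 * bump w t p)).
  by apply: (integrable_bump (f := fun p => modulus p ^+ 2)) => // z;
    apply: cont2M; exact: cont2_modulus.
apply: le_trans (le_Rintegral (mbox w t) iM i12 _) _.
  move=> p _; apply: le_trans (_ : modulus p ^+ 2 * 1 <= _).
    by apply: ler_wpM2l; [exact: sqr_ge0|exact: bump_le1].
  rewrite /mod_dev; have := sqr_ge0 (modulus p - 2).
  by rewrite mulr1 !expr2; lra.
rewrite (RintegralD (mbox w t) ic2 (integrableZl (mbox w t) 2 i1)) RintegralZl//.
rewrite int_box_cst//; move: tS S1 KS.
have -> : 2 * (t + t) ^+ 2 = 8 * t ^+ 2 by ring.
rewrite KE.
move: (t ^+ 2) (4 / d ^+ 2 * S) => tt k; lra.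
Qed.

Local Open Scope ereal_scope.

(** The previous estimate at radius [2 * t]; the ratio [8] of the two squares is the [8] in
    [kernel1]. *)
Lemma local_oscillation_ereal (w : R * R) (t d : R) : (0 < t)%R -> (0 < d <= 1)%R ->
  (820 * d <= 4^-1)%R ->
  \int[mu2]_(p in box w t) (osc2 w p)%:E <=
  (2 * (7 + 8 * (4 / d ^+ 2)))%R%:E * \int[mu2]_(p in box w (8 * t)) (mod_dev p)%:E.
Proof.
move=> t0 d01 dsmall.
have t20 : (0 < 2 * t)%R by rewrite mulr_gt0.
have t80 : (0 < 8 * t)%R by rewrite mulr_gt0.
have := local_oscillation w t20 d01 dsmall.
rewrite [(2 * t)%R]mulrC mulfK// -[(4 * (t * 2))%R](_ : 8 * t = _)%R; last by ring.
have i1 : mu2.-integrable (box w t) (EFin \o osc2 w).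
  by apply: integrable_cont => // p; exact: cont2_osc2.
have i2 : mu2.-integrable (box w (8 * t)) (EFin \o mod_dev).
  by apply: integrable_cont => // p; exact: cont2_mod_dev.
have f1 := integrable_fin_num (mbox w t) i1.
have f2 := integrable_fin_num (mbox w (8 * t)) i2.
rewrite -lee_fin /Rintegral EFinM; move=> h.
by rewrite -[X in X <= _](fineK f1) -[X in _ <= _ * X](fineK f2).
Qed.
End local_oscillation.

(** * From local to global *)

Section gaussian_kernels.
Variable R : realType.
Notation mu := (@lebesgue_measure R).
Notation mu2 := (mu \x mu)%E.
Notation T2 := (measurableTypeR R * measurableTypeR R)%type.
Local Open Scope ereal_scope.

Definition nsq (z : R * R) : R := (z.1 ^+ 2 + z.2 ^+ 2)%R.
Definition gweight (z : R * R) : R := expR (- nsq z).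

Lemma nsq_ge0 z : (0 <= nsq z)%R. Proof. by rewrite addr_ge0 ?sqr_ge0. Qed.
Lemma gweight_ge0 z : (0 <= gweight z)%R. Proof. exact: expR_ge0. Qed.

Lemma measurable_nsq : measurable_fun setT (nsq : T2 -> R).
Proof. by apply: measurable_funD; apply: measurable_funX. Qed.

Lemma measurable_gweight : measurable_fun setT (gweight : T2 -> R).
Proof.
apply: measurableT_comp; first exact: measurable_expR.
by apply: measurableT_comp => //; exact: measurable_nsq.
Qed.

Lemma plane_sigma_finite : sigma_finite setT (mu2 : set T2 -> \bar R).
Proof.
exists (fun n => box (0, 0)%R n.+1%:R).
  apply/seteqP; split=> // p _; pose N := Num.bound (`|p.1| + `|p.2|)%R.
  have hN : (`|p.1| + `|p.2| < N.+1%:R)%R.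
    apply: lt_trans (archi_boundP _) _; first by rewrite addr_ge0.
    by rewrite ltr_nat.
  exists N => //; rewrite /box /csquare /= !in_itv/= !sub0r.
  have := ler_norm p.1; have := ler_norm (- p.1); have := ler_norm p.2.
  have := ler_norm (- p.2); rewrite !normrN; move: hN; move: (N.+1%:R)%R => k.
  have := normr_ge0 p.1; have := normr_ge0 p.2.
  by move: `|p.1|%R `|p.2|%R => a b; split; apply/andP; split; lra.
move=> n; split; first exact: measurable_csquare.
by rewrite [X in X < _]measure_csquare ?ltry// addr_ge0.
Qed.

(* The library does not make the product of two sigma-finite measures canonically
   sigma-finite, which Tonelli's theorem on the product of two planes needs. *)
Definition plane_measure : set T2 -> \bar R := mu2.

HB.instance Definition _ := Measure.copy plane_measure mu2.
HB.instance Definition _ :=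
  Measure_isSigmaFinite.Build _ T2 R plane_measure plane_sigma_finite.

(** Tonelli's theorem: integrating in [z] first replaces the kernel by at most [c * g u].
    Measurability of the inner integral is returned as well, since pointwise bounds by it are
    integrated in [global_bound]. *)
Lemma schur_test (K : T2 * T2 -> R) (f g : T2 -> R) (c : R) :
  (0 <= c)%R -> measurable_fun setT K -> measurable_fun setT f -> measurable_fun setT g ->
  (forall zu, 0 <= K zu)%R -> (forall u, 0 <= f u)%R -> (forall u, 0 <= g u)%R ->
  (forall u, \int[mu2]_z (K (z, u))%:E <= (c * g u)%:E) ->
  measurable_fun setT (fun z => \int[mu2]_u (K (z, u) * f u)%:E) /\
  \int[mu2]_z \int[mu2]_u (K (z, u) * f u)%:E <= c%:E * \int[mu2]_u (f u * g u)%:E.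
Proof.
move=> c0 mK mf mg K0 f0 g0 Kc.
pose Kf (zu : T2 * T2) := (K zu * f zu.2)%:E.
have mKf : measurable_fun setT Kf.
  apply/measurable_EFinP; apply: measurable_funM => //.
  by apply: measurableT_comp => //; exact: measurable_snd.
have Kf0 zu : 0 <= Kf zu by rewrite lee_fin mulr_ge0.
split; first exact: (@measurable_fun_fubini_tonelli_F _ _ _ _ _ plane_measure Kf).
rewrite (@fubini_tonelli _ _ _ _ _ plane_measure plane_measure Kf)//.
have sec u : measurable_fun setT (fun z => (K (z, u))%:E).
  by apply/measurable_EFinP; apply: measurableT_comp => //; exact: measurable_pair2.
have mfg : measurable_fun setT (fun u => (f u * g u)%:E).
  by apply/measurable_EFinP; exact: measurable_funM.
rewrite -ge0_integralZl//; last by move=> u _; rewrite lee_fin mulr_ge0.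
apply: ge0_le_integral => //.
- by move=> u _; apply: integral_ge0 => z _; exact: Kf0.
- exact: (@measurable_fun_fubini_tonelli_G _ _ _ _ _ plane_measure Kf).
- by apply: emeasurable_funM => //; exact: measurable_cst.
move=> u _; rewrite /Kf /=.
under eq_integral do rewrite mulrC EFinM.
rewrite ge0_integralZl//; [|by move=> z _; rewrite lee_fin|by rewrite lee_fin].
have -> : c%:E * (f u * g u)%:E = (f u)%:E * (c * g u)%:E.
  by rewrite -!EFinM mulrCA.
by apply: lee_wpmul2l; [rewrite lee_fin|exact: Kc].
Qed.

Variables (B A2 : R).
Hypothesis B0 : (0 < B)%R.
Hypothesis A2B : (128 * B <= A2)%R.

Let A20 : (0 < A2)%R. Proof. by apply: lt_le_trans A2B; rewrite mulr_gt0. Qed.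

(* Restricts [u] to the square of half side [8 B / |z|] around [z]; the factor
   [|z|^2 / B^2] normalizes by the area. *)
Definition kernel1 (zu : T2 * T2) : R :=
  if [&& A2 <= nsq zu.1, (zu.2.1 - zu.1.1) ^+ 2 * nsq zu.1 <= (8 * B) ^+ 2 &
         (zu.2.2 - zu.1.2) ^+ 2 * nsq zu.1 <= (8 * B) ^+ 2]%R
  then (gweight zu.1 * (nsq zu.1 / B ^+ 2))%R else 0%R.

(* The condition [|u|^2 <= |z|^2 - B / 4] makes the weight gain [exp (- B / 4)]. *)
Definition kernel2 (zu : T2 * T2) : R :=
  if [&& A2 <= nsq zu.1, (zu.2.1 - zu.1.1) ^+ 2 * nsq zu.1 <= B ^+ 2,
         (zu.2.2 - zu.1.2) ^+ 2 * nsq zu.1 <= B ^+ 2 & nsq zu.2 <= nsq zu.1 - B / 4]%R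
  then (gweight zu.1 * (nsq zu.1 / B ^+ 2))%R else 0%R.

Let weight_ge0 z : (0 <= gweight z * (nsq z / B ^+ 2))%R.
Proof. by rewrite mulr_ge0 ?gweight_ge0// divr_ge0 ?nsq_ge0// exprn_ge0// ltW. Qed.

Lemma kernel1_ge0 zu : (0 <= kernel1 zu)%R.
Proof. by rewrite /kernel1; case: ifP => // _; exact: weight_ge0. Qed.

Lemma kernel2_ge0 zu : (0 <= kernel2 zu)%R.
Proof. by rewrite /kernel2; case: ifP => // _; exact: weight_ge0. Qed.

Let mn1 : measurable_fun setT (fun zu : T2 * T2 => nsq zu.1).
Proof. by apply: measurableT_comp; [exact: measurable_nsq|exact: measurable_fst]. Qed.

Let mn2 : measurable_fun setT (fun zu : T2 * T2 => nsq zu.2).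
Proof. by apply: measurableT_comp; [exact: measurable_nsq|exact: measurable_snd]. Qed.

Let mweight : measurable_fun setT (fun zu : T2 * T2 => gweight zu.1 * (nsq zu.1 / B ^+ 2))%R.
Proof.
apply: measurable_funM; last by apply: measurable_funM.
by apply: measurableT_comp; [exact: measurable_gweight|exact: measurable_fst].
Qed.

Let md1 : measurable_fun setT
  (fun zu : T2 * T2 => (zu.2.1 - zu.1.1) ^+ 2 * nsq zu.1)%R.
Proof.
apply: measurable_funM => //; apply: measurable_funX; apply: measurable_funB.
  by apply: measurableT_comp; [exact: measurable_fst|exact: measurable_snd].
by apply: measurableT_comp; [exact: measurable_fst|exact: measurable_fst].
Qed.

Let md2 : measurable_fun setT
  (fun zu : T2 * T2 => (zu.2.2 - zu.1.2) ^+ 2 * nsq zu.1)%R.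
Proof.
apply: measurable_funM => //; apply: measurable_funX; apply: measurable_funB.
  by apply: measurableT_comp; [exact: measurable_snd|exact: measurable_snd].
by apply: measurableT_comp; [exact: measurable_snd|exact: measurable_fst].
Qed.

Lemma measurable_kernel1 : measurable_fun setT kernel1.
Proof.
apply: measurable_fun_ifT => //.
by apply: measurable_and; [|apply: measurable_and]; exact: measurable_fun_ler.
Qed.

Lemma measurable_kernel2 : measurable_fun setT kernel2.
Proof.
apply: measurable_fun_ifT => //.
apply: measurable_and; [exact: measurable_fun_ler|].
apply: measurable_and; [exact: measurable_fun_ler|].
apply: measurable_and; [exact: measurable_fun_ler|].
by apply: measurable_fun_ler => //; exact: measurable_funB.
Qed.

Lemma integral_le_box (k : T2 -> R) (M s : R) (u : R * R) : (0 < s)%R -> (0 <= M)%R ->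
  measurable_fun setT k -> (forall z, 0 <= k z)%R -> (forall z, k z <= M)%R ->
  (forall z, ~ box u s z -> k z = 0%R) ->
  \int[mu2]_z (k z)%:E <= (M * (s + s) ^+ 2)%:E.
Proof.
move=> s0 M0 mk k0 kM kout.
have mb : measurable (box u s : set T2) by exact: measurable_csquare.
have -> : (M * (s + s) ^+ 2)%:E = \int[mu2]_(z in box u s) M%:E.
  by rewrite integral_cst// [X in _ * X]measure_csquare// addr_ge0 ?ltW.
rewrite [X in _ <= X]integral_mkcond; apply: ge0_le_integral => //.
- by move=> z _; rewrite lee_fin.
- exact/measurable_EFinP.
- by apply/(measurable_restrictT _ mb); exact: measurable_cst.
move=> z _; rewrite patchE; case: ifPn => [_|]; first by rewrite lee_fin.
by rewrite notin_setE => /kout ->.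
Qed.

(** [z] stays in a square around [u] of area [4 * (s * B)^2 / |u|^2], where the normalizing factor
    is at most [2 * |u|^2 / B ^+ 2]: both [|u|^2] and [B ^+ 2] cancel. *)
Lemma kernel_section_le (cond : T2 -> bool) (u : R * R) (s E : R) :
  (0 < s)%R -> (0 <= E)%R ->
  measurable_fun setT
    (fun z => if cond z then gweight z * (nsq z / B ^+ 2) else 0 : R)%R ->
  (forall z, cond z -> [/\ (0 < nsq u), (z.1 - u.1) ^+ 2 * nsq u < (s * B) ^+ 2,
     (z.2 - u.2) ^+ 2 * nsq u < (s * B) ^+ 2, gweight z <= E * gweight u &
     nsq z <= 2 * nsq u]%R) ->
  \int[mu2]_z (if cond z then gweight z * (nsq z / B ^+ 2) else 0)%R%:E <=
  (8 * s ^+ 2 * E * gweight u)%:E.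
Proof.
move=> s0 E0 mk H.
have rhs0 : 0 <= (8 * s ^+ 2 * E * gweight u)%:E.
  by rewrite lee_fin !mulr_ge0 ?gweight_ge0 ?exprn_ge0// ltW.
have [u0|u0] := leP (nsq u) 0%R.
  rewrite integral0_eq// => z _; case: ifP => // /H[]; by rewrite ltNge u0.
pose rho := Num.sqrt (nsq u).
have rho0 : (0 < rho)%R by rewrite sqrtr_gt0.
have rho2 : (rho ^+ 2 = nsq u)%R by rewrite sqr_sqrtr// nsq_ge0.
pose M : R := (E * gweight u * (2 * nsq u / B ^+ 2))%R.
have sB0 : (0 < s * B / rho)%R by rewrite divr_gt0// mulr_gt0.
have B20 : (0 < B ^+ 2)%R by rewrite exprn_gt0.
have M0 : (0 <= M)%R.
  apply: mulr_ge0; first by rewrite mulr_ge0 ?gweight_ge0.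
  by rewrite divr_ge0 ?mulr_ge0 ?nsq_ge0// ltW.
apply: le_trans (integral_le_box (u := u) sB0 M0 mk _ _ _) _.
- by move=> z; case: ifP => // _; exact: weight_ge0.
- move=> z; case: ifP => // /H[_ _ _ h1 h2].
  apply: ler_pM => //; first exact: gweight_ge0.
    by rewrite divr_ge0 ?nsq_ge0// ltW.
  by rewrite ler_pM2r ?invr_gt0.
- move=> z nb; case: ifP => // /H[_ h1 h2 _ _]; exfalso; apply: nb.
  have cmp (a : R) : (a ^+ 2 * nsq u < (s * B) ^+ 2 -> `|a| < s * B / rho)%R.
    rewrite -rho2 -exprMn -[X in (X < _)%R]real_normK ?num_real// normrM (gtr0_norm rho0).
    rewrite ltr_pXn2r ?nnegrE//; first by rewrite ltr_pdivlMr.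
      by rewrite mulr_ge0// ltW.
    by rewrite mulr_ge0// ltW.
  by apply: dist_box; exact: cmp.
rewrite lee_fin le_eqVlt; apply/orP; left; apply/eqP.
rewrite /M -rho2; field.
by rewrite !gt_eqF.
Qed.

(** [|u|^2 - |z|^2] is the sum of two terms [a * (2 * x + a)], with [x] a coordinate of [z] and [a]
    its displacement. There [|a * x| <= 8 * B], and [128 * B <= |z|^2] gives [a ^+ 2 <= B / 2]: each
    term is at most [33 / 2 * B]. *)
Lemma near_nsq (z u : R * R) : (A2 <= nsq z)%R ->
  ((u.1 - z.1) ^+ 2 * nsq z <= (8 * B) ^+ 2)%R ->
  ((u.2 - z.2) ^+ 2 * nsq z <= (8 * B) ^+ 2)%R ->
  [/\ (nsq u <= nsq z + 33 * B)%R, (nsq z <= nsq u + 33 * B)%R,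
      (nsq u <= 2 * nsq z)%R & (nsq z <= 2 * nsq u)%R].
Proof.
move=> hz h1 h2.
have n0 : (0 < nsq z)%R by exact: lt_le_trans hz.
have nB : (128 * B <= nsq z)%R by exact: le_trans hz.
have coord (a x : R) : (x ^+ 2 <= nsq z -> a ^+ 2 * nsq z <= (8 * B) ^+ 2 ->
    `|a * (2 * x + a)| <= 33 / 2 * B)%R.
  move=> hx ha.
  have ax : (`|a * x| <= 8 * B)%R.
    rewrite -(@ler_pXn2r _ 2)// ?nnegrE ?normr_ge0//; last by rewrite mulr_ge0// ltW.
    rewrite real_normK ?num_real// exprMn; apply: le_trans ha.
    by apply: ler_wpM2l => //; exact: sqr_ge0.
  have aa : (a ^+ 2 <= B / 2)%R.
    have : (a ^+ 2 * (128 * B) <= (8 * B) ^+ 2)%R.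
      by apply: le_trans ha; apply: ler_wpM2l => //; exact: sqr_ge0.
    have -> : ((8 * B) ^+ 2 = (B / 2) * (128 * B))%R by field.
    by rewrite ler_pM2r// mulr_gt0.
  have -> : (a * (2 * x + a) = 2 * (a * x) + a ^+ 2)%R by ring.
  apply: le_trans (ler_normD _ _) _.
  rewrite normrM (ger0_norm (sqr_ge0 a)) ger0_norm//; lra.
have c1 := coord _ z.1 _ h1; have c2 := coord _ z.2 _ h2.
move: c1 c2; rewrite {1 2}/nsq lerDl lerDr !sqr_ge0 => /(_ isT) c1 /(_ isT) c2.
have : (`|nsq u - nsq z| <= 33 * B)%R.
  have -> : (nsq u - nsq z = (u.1 - z.1) * (2 * z.1 + (u.1 - z.1)) +
     (u.2 - z.2) * (2 * z.2 + (u.2 - z.2)))%R by rewrite /nsq; ring.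
  by apply: le_trans (ler_normD _ _) _; lra.
rewrite ler_norml => /andP[g1 g2].
by split; lra.
Qed.

Lemma near_dist (z u : R * R) (a x y : R) : (0 < nsq z)%R -> (nsq u <= 2 * nsq z)%R ->
  ((y - x) ^+ 2 * nsq z <= (a * B) ^+ 2)%R ->
  ((x - y) ^+ 2 * nsq u <= 2 * (a * B) ^+ 2)%R.
Proof.
move=> n0 hn h; apply: le_trans (_ : (x - y) ^+ 2 * (2 * nsq z) <= _)%R.
  by apply: ler_wpM2l => //; exact: sqr_ge0.
have -> : ((x - y) ^+ 2 * (2 * nsq z) = 2 * ((y - x) ^+ 2 * nsq z))%R by ring.
by rewrite ler_pM2l.
Qed.

(** Recentring the square from [z] to [u] costs the factor [sqrt 2] of [near_dist]; [12] exceeds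
    [8 * sqrt 2], and [1152 = 8 * 12 ^+ 2]. *)
Lemma kernel1_int (u : R * R) :
  \int[mu2]_z (kernel1 (z, u))%:E <= (1152 * expR (33 * B) * gweight u)%:E.
Proof.
have mk : measurable_fun setT (fun z : T2 => kernel1 (z, u)).
  by apply: measurableT_comp; [exact: measurable_kernel1|exact: measurable_pair2].
have -> : (1152 = 8 * 12 ^+ 2 :> R)%R by rewrite -natrX -natrM.
apply: (kernel_section_le (s := 12) (E := expR (33 * B)) _ _ mk) => //.
move=> z /and3P[hz h1 h2].
have n0 : (0 < nsq z)%R by exact: lt_le_trans hz.
have [g1 g2 g3 g4] := near_nsq hz h1 h2.
have B20 : (0 < B ^+ 2)%R by rewrite exprn_gt0.
have d1 := near_dist n0 g3 h1; have d2 := near_dist n0 g3 h2.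
have lt144 : (2 * (8 * B) ^+ 2 < (12 * B) ^+ 2)%R by rewrite !exprMn; lra.
split=> //; first by lra.
- exact: le_lt_trans d1 lt144.
- exact: le_lt_trans d2 lt144.
- by rewrite /gweight -expRD ler_expR; lra.
Qed.

(** Same count with half side [B / |z|]: [2] exceeds [sqrt 2], and [32 = 8 * 2 ^+ 2]. The inward
    condition turns the loss [33 * B] in the exponent into the gain [B / 4]. *)
Lemma kernel2_int (u : R * R) :
  \int[mu2]_z (kernel2 (z, u))%:E <= (32 * expR (- (B / 4)) * gweight u)%:E.
Proof.
have mk : measurable_fun setT (fun z : T2 => kernel2 (z, u)).
  by apply: measurableT_comp; [exact: measurable_kernel2|exact: measurable_pair2].
have -> : (32 = 8 * 2 ^+ 2 :> R)%R by rewrite -natrX -natrM.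
apply: (kernel_section_le (s := 2) (E := expR (- (B / 4))) _ _ mk) => //.
move=> z /and4P[hz h1 h2 h3].
have n0 : (0 < nsq z)%R by exact: lt_le_trans hz.
have B20 : (0 < B ^+ 2)%R by rewrite exprn_gt0.
have lt64 : (B ^+ 2 <= (8 * B) ^+ 2)%R by rewrite !exprMn; lra.
have [g1 g2 g3 g4] := near_nsq hz (le_trans h1 lt64) (le_trans h2 lt64).
have h1' : ((u.1 - z.1) ^+ 2 * nsq z <= (1 * B) ^+ 2)%R by rewrite mul1r.
have h2' : ((u.2 - z.2) ^+ 2 * nsq z <= (1 * B) ^+ 2)%R by rewrite mul1r.
have d1 := near_dist n0 g3 h1'; have d2 := near_dist n0 g3 h2'.
have lt4 : (2 * (1 * B) ^+ 2 < (2 * B) ^+ 2)%R by rewrite !exprMn; lra.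
split=> //; first by lra.
- exact: le_lt_trans d1 lt4.
- exact: le_lt_trans d2 lt4.
- by rewrite /gweight -expRD ler_expR; lra.
Qed.
End gaussian_kernels.

(** * Propagation towards the origin and absorption *)

Section fock_stability.
Variable R : realType.
Notation mu := (@lebesgue_measure R).
Notation mu2 := (mu \x mu)%E.
Notation T2 := (measurableTypeR R * measurableTypeR R)%type.
Variables U V : R * R -> R.
Hypothesis holUV : forall p, holo2 U V p.
Variables (d B A2 : R).
Hypothesis d01 : 0 < d <= 1.
Hypothesis dsmall : 820 * d <= 4^-1.
Hypothesis B0 : 0 < B.
Hypothesis A2B : 128 * B <= A2.

Let C : R := 2 * (7 + 8 * (4 / d ^+ 2)).
Let h := osc2 U V (0, 0).
Let dev := mod_dev U V.

Let C0 : 0 <= C.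
Proof.
have d0 : 0 < d by case/andP: d01.
rewrite mulr_ge0// addr_ge0// mulr_ge0// divr_ge0// exprn_ge0//; exact: ltW.
Qed.

Let h0 u : 0 <= h u. Proof. exact: osc2_ge0. Qed.
Let dev0 u : 0 <= dev u. Proof. exact: mod_dev_ge0. Qed.

Let mosc w : measurable_fun setT (osc2 U V w : T2 -> R).
Proof. by apply: cont2_measurable => p; exact: cont2_osc2. Qed.

Let mdev : measurable_fun setT (dev : T2 -> R).
Proof. by apply: cont2_measurable => p; exact: cont2_mod_dev. Qed.

Let mbox w t : measurable (box w t : set T2). Proof. exact: measurable_csquare. Qed.

Lemma osc2_triangle (z u : R * R) : h z <= 2 * osc2 U V z u + 2 * h u.
Proof.
rewrite /h /osc2.
have := sqr_ge0 ((U u - U z) + (U u - U (0, 0))).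
have := sqr_ge0 ((V u - V z) + (V u - V (0, 0))).
rewrite !expr2; nra.
Qed.

(* Moves [z] towards the origin by half of [B / |z|]. *)
Let inward (z : R * R) : R * R :=
  ((1 - B / (2 * nsq z)) * z.1, (1 - B / (2 * nsq z)) * z.2).

Lemma far_norm (z : R * R) : A2 <= nsq z -> [/\ 0 < nsq z, 128 * B <= nsq z,
  0 < Num.sqrt (nsq z) & Num.sqrt (nsq z) ^+ 2 = nsq z].
Proof.
move=> hz; have hB := le_trans A2B hz.
have n0 : 0 < nsq z by apply: lt_le_trans hB; rewrite mulr_gt0.
by split=> //; [rewrite sqrtr_gt0|rewrite sqr_sqrtr// ltW].
Qed.

Lemma abs_le_sqrt_nsq (z : R * R) : 0 < Num.sqrt (nsq z) ->
  Num.sqrt (nsq z) ^+ 2 = nsq z ->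
  `|z.1| <= Num.sqrt (nsq z) /\ `|z.2| <= Num.sqrt (nsq z).
Proof.
move=> r0 r2; have r0' := ltW r0.
by split; rewrite -(@ler_pXn2r _ 2)// ?nnegrE// r2 real_normK ?num_real//
  /nsq ?lerDl ?lerDr sqr_ge0.
Qed.

(** The shrinking lowers [|z|^2] by at least [B - B / 512]. Spreading over the square adds a cross
    term of at most [B / 4] per coordinate, and two squares of at most [B / 512]. *)
Lemma inward_box (z u : R * R) : A2 <= nsq z ->
  box (inward z) (B / Num.sqrt (nsq z) / 8) u ->
  [/\ `|u.1 - z.1| <= 5 / 8 * (B / Num.sqrt (nsq z)),
      `|u.2 - z.2| <= 5 / 8 * (B / Num.sqrt (nsq z)) & nsq u <= nsq z - B / 4].
Proof.
move=> hz; have [n0 nB r0 r2] := far_norm hz.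
have [z1 z2] := abs_le_sqrt_nsq r0 r2.
move=> /box_dist[]; rewrite /inward /=.
set rho := Num.sqrt (nsq z) in r0 r2 z1 z2 *.
set c := B / (2 * nsq z).
have c0 : 0 <= c by rewrite divr_ge0 ?mulr_ge0// ltW.
have c1 : c <= 1 by rewrite ler_pdivrMr ?mulr_gt0//; lra.
have crho : c * rho = B / rho / 2 by rewrite /c -r2; field; rewrite gt_eqF.
have step (x y : R) : `|x| <= rho -> `|y - (1 - c) * x| <= B / rho / 8 ->
    `|y - x| <= 5 / 8 * (B / rho) /\
    y ^+ 2 <= (1 - c) ^+ 2 * x ^+ 2 + (B / 4 + (B / rho / 8) ^+ 2).
  move=> hx hy; split.
    have -> : y - x = (y - (1 - c) * x) - c * x by ring.
    apply: le_trans (ler_normB _ _) _; rewrite [`|c * x|]normrM (ger0_norm c0).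
    have : c * `|x| <= c * rho by apply: ler_wpM2l.
    by rewrite crho; lra.
  set e := y - (1 - c) * x in hy *.
  have -> : y ^+ 2 = (1 - c) ^+ 2 * x ^+ 2 + (2 * ((1 - c) * (x * e)) + e ^+ 2).
    by rewrite /e; ring.
  rewrite lerD2l; apply: lerD; last first.
    rewrite -(real_normK (num_real e)); apply: lerXn2r => //; rewrite nnegrE.
    exact: le_trans (normr_ge0 _) hy.
  have xe : `|x * e| <= B / 8.
    rewrite normrM; apply: le_trans (_ : rho * (B / rho / 8) <= _); first exact: ler_pM.
    by rewrite le_eqVlt; apply/orP; left; apply/eqP; field; rewrite gt_eqF.
  have : (1 - c) * `|x * e| <= 1 * (B / 8) by apply: ler_pM => //; lra.
  have : (1 - c) * (x * e) <= (1 - c) * `|x * e|.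
    by apply: ler_wpM2l; [lra|exact: ler_norm].
  lra.
move=> /(step _ _ z1)[g1 g2] /(step _ _ z2)[g3 g4]; split=> //.
have : nsq u <= (1 - c) ^+ 2 * nsq z + (B / 2 + 2 * (B / rho / 8) ^+ 2).
  by rewrite [nsq u]/nsq [in X in _ <= X]/nsq; lra.
have Bn : B * (128 * B) <= B * nsq z by rewrite ler_pM2l.
have Bn0 : 0 < B * nsq z by rewrite mulr_gt0.
have b1 : (1 - c) ^+ 2 * nsq z <= nsq z - B + B / 512.
  have -> : (1 - c) ^+ 2 * nsq z = nsq z - B + B ^+ 2 / (4 * nsq z).
    by rewrite /c; field; rewrite gt_eqF.
  by rewrite lerD2l ler_pdivrMr ?mulr_gt0//; move: Bn Bn0; rewrite expr2; lra.
have b2 : (B / rho / 8) ^+ 2 <= B / 512.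
  have -> : (B / rho / 8) ^+ 2 = B ^+ 2 / (64 * nsq z).
    by rewrite -r2; field; rewrite gt_eqF.
  by rewrite ler_pdivrMr ?mulr_gt0//; move: Bn Bn0; rewrite expr2; lra.
move=> b3; apply: le_trans b3 _; apply: le_trans (lerD b1 (lerD (lexx (B / 2))
  (ler_wpM2l _ b2))) _ => //.
by move: B0 => b0; lra.
Qed.

Let K1 := kernel1 B A2.
Let K2 := kernel2 B A2.

Local Open Scope ereal_scope.

(** With [r = B / |z|], [h z] is averaged over a square of area [r ^+ 2 / 16] by means of
    [osc2_triangle]; this square lies in [box z r], where the local estimate bounds the oscillation
    around [z]. The kernels carry the weight divided by [r ^+ 2], hence the factor [16 * 2] in both
    terms. *)
Lemma far_pointwise (z : R * R) : (A2 <= nsq z)%R ->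
  (h z * gweight z)%:E <=
    (32 * C)%:E * \int[mu2]_u (K1 (z, u) * dev u)%:E +
    32%:E * \int[mu2]_u (K2 (z, u) * h u)%:E.
Proof.
move=> hz; have [n0 nB r0 r2] := far_norm hz.
set rho := Num.sqrt (nsq z) in r0 r2.
pose r : R := (B / rho)%R.
have r_gt0 : (0 < r)%R by rewrite divr_gt0.
have B20 : (0 < B ^+ 2)%R by rewrite exprn_gt0.
pose k : R := (gweight z * (nsq z / B ^+ 2))%R.
have k0 : (0 <= k)%R by rewrite mulr_ge0 ?gweight_ge0// divr_ge0 ?nsq_ge0// ltW.
pose D := box (inward z) (r / 8).
have mD : measurable (D : set T2) by exact: mbox.
have Dz : D `<=` box z r.
  have r58 : (5 / 8 * r < r)%R by lra.
  by move=> u /(inward_box hz)[u1 u2 _]; apply: dist_box; apply: le_lt_trans r58.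
(* Converts distances to the division-free form tested by the kernels. *)
have sq_rho (y x a : R) : (0 <= a)%R -> (`|y - x| <= a * r)%R ->
    ((y - x) ^+ 2 * nsq z <= (a * B) ^+ 2)%R.
  move=> a0 hyx; rewrite -r2 -exprMn -[X in (X <= _)%R]real_normK ?num_real//.
  rewrite normrM (gtr0_norm r0); apply: lerXn2r => //.
  - by rewrite nnegrE mulr_ge0// ltW.
  - by rewrite nnegrE mulr_ge0// ltW.
  - apply: le_trans (_ : a * r * rho <= _)%R; first by apply: ler_wpM2r => //; exact: ltW.
    by rewrite /r -mulrA divfK// gt_eqF.
pose I1 := \int[mu2]_(u in box z (8 * r)) (dev u)%:E.
pose I2 := \int[mu2]_(u in D) (h u)%:E.
have mfh D' : measurable_fun D' (fun u : T2 => (h u)%:E).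
  by apply/measurable_EFinP; apply: measurable_funTS; exact: mosc.
have mfd D' : measurable_fun D' (fun u : T2 => (dev u)%:E).
  by apply/measurable_EFinP; apply: measurable_funTS; exact: mdev.
have mfo D' : measurable_fun D' (fun u : T2 => (osc2 U V z u)%:E).
  by apply/measurable_EFinP; apply: measurable_funTS; exact: mosc.
have I1K : k%:E * I1 <= \int[mu2]_u (K1 (z, u) * dev u)%:E.
  rewrite /I1 -ge0_integralZl//; last first.
    by move=> u _; rewrite lee_fin.
  rewrite integral_mkcond; apply: ge0_le_integral => //.
  - by move=> u _; rewrite patchE; case: ifP => // _; rewrite -EFinM lee_fin mulr_ge0.
  - apply/(measurable_restrictT _ (mbox _ _)).
    by apply: emeasurable_funM => //; exact: measurable_cst.
  - apply/measurable_EFinP; apply: measurable_funM => //.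
    by apply: measurableT_comp; [exact: measurable_kernel1|exact: measurable_pair1].
  move=> u _; rewrite patchE; case: ifPn => [|_]; last first.
    by rewrite lee_fin mulr_ge0// kernel1_ge0.
  rewrite inE => /box_dist[u1 u2].
  by rewrite /K1 /kernel1 /= hz !sq_rho// -EFinM.
have I2K : k%:E * I2 <= \int[mu2]_u (K2 (z, u) * h u)%:E.
  rewrite /I2 -ge0_integralZl//; last by move=> u _; rewrite lee_fin.
  rewrite integral_mkcond; apply: ge0_le_integral => //.
  - by move=> u _; rewrite patchE; case: ifP => // _; rewrite -EFinM lee_fin mulr_ge0.
  - apply/(measurable_restrictT _ mD).
    by apply: emeasurable_funM => //; exact: measurable_cst.
  - apply/measurable_EFinP; apply: measurable_funM => //; last exact: mosc.
    by apply: measurableT_comp; [exact: measurable_kernel2|exact: measurable_pair1].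
  move=> u _; rewrite patchE; case: ifPn => [|_]; last first.
    by rewrite lee_fin mulr_ge0// kernel2_ge0.
  rewrite inE => /(inward_box hz)[]; rewrite -/rho -/r => u1 u2 u3.
  have le1 (y x : R) : (`|y - x| <= 5 / 8 * r -> (y - x) ^+ 2 * nsq z <= B ^+ 2)%R.
    by move=> hyx; have := sq_rho y x 1%R ler01; rewrite !mul1r; apply; lra.
  by rewrite /K2 /kernel2 /= hz u3 !le1// -EFinM.
have main : (h z * (r / 8 + r / 8) ^+ 2)%:E <= 2%:E * (C%:E * I1) + 2%:E * I2.
  have -> : (h z * (r / 8 + r / 8) ^+ 2)%:E = \int[mu2]_(u in D) (h z)%:E.
    rewrite integral_cst// [X in _ * X]measure_csquare//.
    by rewrite addr_ge0 ?divr_ge0// ltW.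
  apply: le_trans (_ : \int[mu2]_(u in D) (2%:E * (osc2 U V z u)%:E + 2%:E * (h u)%:E) <= _).
    apply: ge0_le_integral => //.
    - by move=> u _; rewrite lee_fin.
    - by apply: emeasurable_funD; apply: emeasurable_funM => //; exact: measurable_cst.
    - by move=> u _; rewrite -!EFinM -EFinD lee_fin; exact: osc2_triangle.
  rewrite ge0_integralD//; last first.
  - by apply: emeasurable_funM => //; exact: measurable_cst.
  - by move=> u _; rewrite -EFinM lee_fin mulr_ge0.
  - by apply: emeasurable_funM => //; exact: measurable_cst.
  - by move=> u _; rewrite -EFinM lee_fin mulr_ge0// osc2_ge0.
  have pos1 u : D u -> 0 <= (h u)%:E by rewrite lee_fin.
  have pos2 u : D u -> 0 <= (osc2 U V z u)%:E by rewrite lee_fin osc2_ge0.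
  rewrite !ge0_integralZl//.
  apply: leeD => //; apply: lee_wpmul2l; first by rewrite lee_fin.
  apply: le_trans (local_oscillation_ereal holUV z r_gt0 d01 dsmall).
  apply: ge0_subset_integral => //.
  by move=> u _; rewrite lee_fin osc2_ge0.
have hk : (h z * gweight z)%:E = (16 * k)%:E * (h z * (r / 8 + r / 8) ^+ 2)%:E.
  rewrite -EFinM; congr (_ %:E); rewrite /k /r -r2; field.
  by rewrite !gt_eqF.
have I10 : 0 <= I1 by apply: integral_ge0 => u _; rewrite lee_fin.
have I20 : 0 <= I2 by apply: integral_ge0 => u _; rewrite lee_fin.
rewrite hk; apply: le_trans (lee_wpmul2l _ main) _.
  by rewrite lee_fin mulr_ge0.
have -> : (16 * k)%:E * (2%:E * (C%:E * I1) + 2%:E * I2) =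
    (32 * C)%:E * (k%:E * I1) + 32%:E * (k%:E * I2).
  rewrite ge0_muleDr; [|by rewrite !mule_ge0// lee_fin|by rewrite !mule_ge0].
  rewrite !muleA -!EFinM; congr (_ %:E * _ + _ %:E * _); ring.
have C32 : 0 <= (32 * C)%:E by rewrite lee_fin; apply: mulr_ge0.
by apply: leeD; apply: lee_wpmul2l => //; rewrite lee_fin.
Qed.

(** On the square of half side [8 * T], [|z|^2 <= 2 * (8 * T)^2], which bounds the weight from
    below. *)
Lemma near_integral (T : R) : (0 < T)%R ->
  \int[mu2]_(z in box (0, 0)%R T) (h z)%:E <=
  (C * expR (128 * T ^+ 2))%:E * \int[mu2]_z (dev z * gweight z)%:E.
Proof.
move=> T0; have mbT : measurable (box (0, 0)%R (8 * T) : set T2) by exact: mbox.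
apply: le_trans (local_oscillation_ereal holUV _ T0 d01 dsmall) _.
rewrite -/C [(C * expR _)%:E]EFinM -muleA; apply: lee_wpmul2l; first by rewrite lee_fin.
have mdg : measurable_fun setT (fun z : T2 => (dev z * gweight z)%:E).
  by apply/measurable_EFinP; apply: measurable_funM => //; exact: measurable_gweight.
have dg0 z : 0 <= (dev z * gweight z)%:E by rewrite lee_fin mulr_ge0 ?gweight_ge0.
rewrite -ge0_integralZl//.
rewrite [X in X <= _]integral_mkcond; apply: ge0_le_integral => //.
- by move=> u _; rewrite patchE; case: ifP => // _; rewrite lee_fin.
- apply/(measurable_restrictT _ mbT)/measurable_EFinP; apply: measurable_funTS.
  exact: mdev.
- by apply: emeasurable_funM => //; exact: measurable_cst.
move=> u _; rewrite patchE; case: ifPn => [|_]; last first.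
  by rewrite -EFinM lee_fin mulr_ge0 ?expR_ge0// mulr_ge0 ?gweight_ge0.
rewrite inE => /box_dist[]; rewrite /= !subr0 => u1 u2.
rewrite -EFinM lee_fin mulrCA ler_peMr// /gweight -expRD -[leLHS]expR0 ler_expR subr_ge0.
have sq (x : R) : (`|x| <= 8 * T -> x ^+ 2 <= 64 * T ^+ 2)%R.
  move=> hx; rewrite -(real_normK (num_real x)).
  have -> : (64 * T ^+ 2 = (8 * T) ^+ 2)%R by ring.
  by apply: lerXn2r => //; rewrite nnegrE// mulr_ge0// ltW.
by rewrite /nsq; have := sq _ u1; have := sq _ u2; lra.
Qed.

(* Since [h z] is controlled by [h] closer to the origin, where the weight is
   larger, the second term of [far_pointwise] integrates to at most half of the
   left-hand side, which is finite and can be absorbed. *)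
Lemma global_bound :
  (32 * (32 * expR (- (B / 4))) <= 2^-1)%R ->
  \int[mu2]_z (h z * gweight z)%:E < +oo ->
  \int[mu2]_z (h z * gweight z)%:E <=
  (2 * (C * expR (128 * (A2 + 1) ^+ 2) + 32 * C * (1152 * expR (33 * B))))%:E *
    \int[mu2]_z (dev z * gweight z)%:E.
Proof.
move=> gain Xfin.
have A20 : (0 < A2)%R by apply: lt_le_trans A2B; rewrite mulr_gt0.
have d0 : (0 < d)%R by case/andP: d01.
have Cgt0 : (0 < C)%R.
  by rewrite mulr_gt0// addr_gt0// mulr_gt0// divr_gt0// exprn_gt0.
(* [A2 < T ^+ 2], so the disc [|z|^2 < A2] lies in [box (0, 0) T]. *)
pose T : R := (A2 + 1)%R; have T0 : (0 < T)%R by rewrite addr_gt0.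
have mh : measurable_fun setT (h : T2 -> R) by exact: mosc.
have [m1 s1] := schur_test (mulr_ge0 (ler0n R 1152) (expR_ge0 (33 * B)%R))
  (measurable_kernel1 B A2) mdev (@measurable_gweight R)
  (kernel1_ge0 A2 B0) dev0 (@gweight_ge0 R) (kernel1_int B0 A2B).
have [m2 s2] := schur_test (mulr_ge0 (ler0n R 32) (expR_ge0 (- (B / 4))%R))
  (measurable_kernel2 B A2) mh (@measurable_gweight R)
  (kernel2_ge0 A2 B0) h0 (@gweight_ge0 R) (kernel2_int B0 A2B).
have near := near_integral T0.
move: near s1 s2; set X := \int[mu2]_z (h z * gweight z)%:E in Xfin *.
set Y := \int[mu2]_z (dev z * gweight z)%:E.
set N := \int[mu2]_(z in _) _.
set S1 := \int[mu2]_z _; set S2 := \int[mu2]_z _ => near s1 s2.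
have C32 : (0 <= 32 * C)%R by rewrite mulr_ge0// ltW.
have k1 zu : (0 <= kernel1 B A2 zu)%R by exact: kernel1_ge0.
have k2 zu : (0 <= kernel2 B A2 zu)%R by exact: kernel2_ge0.
have mbT : measurable (box (0, 0)%R T : set T2) by exact: mbox.
have mN : measurable_fun setT ((fun z : T2 => (h z)%:E) \_ (box (0, 0)%R T)).
  by apply/(measurable_restrictT _ mbT)/measurable_EFinP; apply: measurable_funTS.
have N0 z : 0 <= ((fun z : T2 => (h z)%:E) \_ (box (0, 0)%R T)) z.
  by rewrite patchE; case: ifP => // _; rewrite lee_fin.
have i10 z : 0 <= \int[mu2]_u (kernel1 B A2 (z, u) * dev u)%:E.
  by apply: integral_ge0 => u _; rewrite lee_fin mulr_ge0.
have i20 z : 0 <= \int[mu2]_u (kernel2 B A2 (z, u) * h u)%:E.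
  by apply: integral_ge0 => u _; rewrite lee_fin mulr_ge0.
have c10 z : 0 <= (32 * C)%:E * \int[mu2]_u (kernel1 B A2 (z, u) * dev u)%:E.
  by rewrite mule_ge0// lee_fin.
have c20 z : 0 <= 32%:E * \int[mu2]_u (kernel2 B A2 (z, u) * h u)%:E.
  by rewrite mule_ge0// lee_fin.
have mc1 : measurable_fun setT
    (fun z => (32 * C)%:E * \int[mu2]_u (kernel1 B A2 (z, u) * dev u)%:E).
  by apply: emeasurable_funM => //; exact: measurable_cst.
have mc2 : measurable_fun setT
    (fun z => 32%:E * \int[mu2]_u (kernel2 B A2 (z, u) * h u)%:E).
  by apply: emeasurable_funM => //; exact: measurable_cst.
have step : X <= N + ((32 * C)%:E * S1 + 32%:E * S2).
  rewrite /N /S1 /S2 [X in _ <= X + _]integral_mkcond.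
  rewrite -ge0_integralZl// -[X in _ <= _ + (_ + X)]ge0_integralZl//.
  rewrite -ge0_integralD// -ge0_integralD//; last 2 first.
  - by move=> z _; rewrite adde_ge0.
  - exact: emeasurable_funD.
  apply: ge0_le_integral => //.
  - by move=> z _; rewrite lee_fin mulr_ge0 ?gweight_ge0.
  - by apply/measurable_EFinP; apply: measurable_funM => //; exact: measurable_gweight.
  - by apply: emeasurable_funD => //; exact: emeasurable_funD.
  move=> z _; have [hz|hz] := leP A2 (nsq z).
    apply: le_trans (far_pointwise hz) _.
    by rewrite leeDr// N0.
  apply: le_trans (_ : (h z)%:E <= _).
    by rewrite lee_fin ler_piMr// /gweight -[leRHS]expR0 ler_expR oppr_le0 nsq_ge0.
  rewrite patchE mem_set; first by rewrite leeDl// adde_ge0.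
  have sq (x : R) : (x ^+ 2 <= nsq z -> `|x - 0| < T)%R.
    move=> hx; rewrite subr0.
    rewrite -(@ltr_pXn2r _ 2)// ?nnegrE ?normr_ge0 ?(ltW T0)// real_normK ?num_real//.
    apply: le_lt_trans hx (lt_le_trans hz _).
    by rewrite /T sqrrD expr1n; have := sqr_ge0 A2; lra.
  by apply: dist_box; apply: sq; rewrite /nsq ?lerDl ?lerDr sqr_ge0.
have X0 : 0 <= X by apply: integral_ge0 => z _; rewrite lee_fin mulr_ge0 ?gweight_ge0.
have Y0 : 0 <= Y by apply: integral_ge0 => z _; rewrite lee_fin mulr_ge0 ?gweight_ge0.
set a1 : R := (C * expR (128 * (A2 + 1) ^+ 2))%R in near *.
set a2 : R := (1152 * expR (33 * B))%R in s1 *.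
have a10 : (0 < a1)%R by rewrite mulr_gt0 ?expR_gt0.
have a20 : (0 < a2)%R by apply: mulr_gt0; [rewrite ltr0n|exact: expR_gt0].
clearbody a1 a2.
have K0 : (0 < 2 * (a1 + 32 * C * a2))%R.
  by rewrite mulr_gt0// addr_gt0// mulr_gt0// mulr_gt0.
have step2 : X <= a1%:E * Y + ((32 * C)%:E * (a2%:E * Y) +
    32%:E * ((32 * expR (- (B / 4)))%:E * X)).
  apply: le_trans step _; apply: leeD => //.
  by apply: leeD; apply: lee_wpmul2l => //; rewrite lee_fin.
have Xf : X \is a fin_num by rewrite ge0_fin_numE.
(* For [Y] infinite the bound is trivial; otherwise all terms are real and the last one, at most
   [X / 2], moves to the left. *)
have [Yf|] := boolP (Y \is a fin_num); last first.
  rewrite ge0_fin_numE// -leNgt leye_eq => /eqP ->.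
  by rewrite gt0_muley ?lte_fin// leey.
move: step2; rewrite -(fineK Xf) -(fineK Yf) -!EFinM -!EFinD !lee_fin.
have x0 : (0 <= fine X)%R by rewrite fine_ge0.
move: (fine X) (fine Y) x0 => x y x0.
have := ler_wpM2r x0 gain.
have -> : (32 * (32 * expR (- (B / 4))) * x = 32 * (32 * expR (- (B / 4)) * x))%R by ring.
have -> : (2 * (a1 + 32 * C * a2) * y = 2 * (a1 * y + 32 * C * (a2 * y)))%R by ring.
move: (a1 * y)%R (32 * C * (a2 * y))%R (32 * (32 * expR (- (B / 4)) * x))%R => p q r.
lra.
Qed.
End fock_stability.

(** * Fock norms as Gaussian integrals *)

Section fock_space_facts.
Variable R : realType.
Notation mu := (@lebesgue_measure R).
Notation mu2 := (mu \x mu)%E.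
Notation T2 := (measurableTypeR R * measurableTypeR R)%type.
Local Open Scope ereal_scope.

Lemma gweight_integrable : \int[mu2]_z (gweight z)%:E < +oo.
Proof.
pose f (z : T2) : \bar R := (gweight z)%:E.
have mf : measurable_fun setT f by apply/measurable_EFinP; exact: measurable_gweight.
have f0 z : 0 <= f z by rewrite lee_fin gweight_ge0.
rewrite (@fubini_tonelli1 _ _ _ _ _ mu mu f mf f0) /fubini_F.
have E x : \int[mu]_y f (x, y) = (gauss_fun x)%:E * (Num.sqrt pi)%:E.
  rewrite -integralT_gauss -ge0_integralZl//.
  - apply: eq_integral => y _; rewrite /f /gweight /nsq /= /gauss_fun opprD expRD.
    by rewrite EFinM.
  - by apply/measurable_EFinP; exact: measurable_gauss_fun.
  - by move=> y _; rewrite lee_fin gauss_fun_ge0.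
  - by rewrite lee_fin gauss_fun_ge0.
under eq_integral do rewrite E muleC.
rewrite ge0_integralZl//.
- by rewrite integralT_gauss -EFinM ltry.
- by apply/measurable_EFinP; exact: measurable_gauss_fun.
- by move=> y _; rewrite lee_fin gauss_fun_ge0.
Qed.

Lemma normc_pair (x y : R) : (Normc.normc (x +i* y)%C ^+ 2 = x ^+ 2 + y ^+ 2)%R.
Proof. by rewrite /= sqr_sqrtr// addr_ge0 ?sqr_ge0. Qed.

Lemma normc_modulus (F : R[i] -> R[i]) p :
  Normc.normc (F (p.1 +i* p.2)%C) = modulus (re_part F) (im_part F) p.
Proof. by rewrite /modulus /re_part /im_part; case: (F _). Qed.

Lemma fock_normE (F : R[i] -> R[i]) :
  fock_norm F = sqrte ((pi^-1)%:E *
    \int[mu2]_p (Normc.normc (F (p.1 +i* p.2)%C) ^+ 2 * gweight p)%:E).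
Proof.
by rewrite /fock_norm; congr (sqrte (_ * _)); apply: eq_integral => p _;
  rewrite normc_pair.
Qed.

Lemma fock_integral_finite (F : R[i] -> R[i]) : fock_norm F < +oo ->
  \int[mu2]_p (Normc.normc (F (p.1 +i* p.2)%C) ^+ 2 * gweight p)%:E < +oo.
Proof.
rewrite fock_normE; set I := \int[_]_p _ => h; rewrite ltNge leye_eq.
apply/negP => /eqP IE; move: h; rewrite IE gt0_muley ?lte_fn//.
by rewrite lte_fin invr_gt0 pi_gt0.
Qed.

Lemma expR_decay (c : R) : (0 < c)%R -> exists2 B : R, (0 < B)%R &
  (c * expR (- (B / 4)) <= 2^-1)%R.
Proof.
(* With this [B], [exp (B / 4) >= 1 + 2 * c]. *)
move=> c0; exists (8 * c)%R; first by rewrite mulr_gt0.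
have -> : (8 * c / 4 = 2 * c)%R by field.
rewrite expRN ler_pdivrMr ?expR_gt0//.
have := expR_ge1Dx (2 * c)%R; lra.
Qed.

End fock_space_facts.

(** * From [F 0] to a unimodular constant *)

Section fock_distance.
Variable R : realType.

Lemma nearest_unit (z : R[i]) : exists2 l : R[i], (`|l| = 1) &
  Normc.normc (z - l) = (`|Normc.normc z - 1|).
Proof.
pose r : R := Normc.normc z.
have nE (x : R[i]) : `|x| = (Normc.normc x)%:C%C by [].
(* Every unimodular [l] is at distance [1] from [0]; otherwise [l] is [z / |z|]. *)
have [z0|z0] := eqVneq z 0.
  exists 1; first by rewrite normr1.
  by rewrite z0 sub0r normcN Normc.normc0 Normc.normc1 sub0r normrN normr1.
have r0 : r != 0 by apply: contra z0 => /eqP /Normc.eq0_normc ->.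
have r00 : (r%:C)%C != 0 :> R[i] by rewrite eq_complex /= negb_and r0.
have rpos : (0 <= r) by rewrite /r; case: (z) => a b /=; exact: sqrtr_ge0.
exists (z / (r%:C)%C).
  rewrite normrM normfV nE -/r nE.
  have -> : Normc.normc (r%:C)%C = r by rewrite /= expr0n addr0 sqrtr_sqr ger0_norm.
  by rewrite divff.
have -> : (z - z / (r%:C)%C = z / (r%:C)%C * ((r - 1)%:C)%C).
  rewrite rmorphB/= mulrBr divfK// mulr1//.
rewrite Normc.normcM Normc.normcM Normc.normcV -/r.
have cE (x : R) : Normc.normc (x%:C)%C = `|x| by rewrite /= expr0n addr0 sqrtr_sqr.
by rewrite !cE (ger0_norm rpos) divff// mul1r.
Qed.

(** Going through [F 0] twice bounds [|F p - l|] by [2 * |F p - F 0|] plus the deviation of [|F p|]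
    from [1]; squaring the sum yields [8] and [2]. *)
Lemma fock_pointwise (F : R[i] -> R[i]) (l : R[i]) (p : R * R) :
  Normc.normc (F 0 - l) = (`|Normc.normc (F 0) - 1|) ->
  (Normc.normc (F (p.1 +i* p.2)%C - l) ^+ 2 <=
   8 * osc2 (re_part F) (im_part F) (0, 0) p +
   2 * mod_dev (re_part F) (im_part F) p).
Proof.
move=> hl; set z := F (p.1 +i* p.2)%C.
pose q := Normc.normc (z - F 0); pose r := Normc.normc z.
have qE : (osc2 (re_part F) (im_part F) (0, 0) p = q ^+ 2).
  rewrite /osc2 /re_part /im_part -/z /q.
  have -> : (0, 0).1 +i* (0, 0).2 = 0 :> R[i] by [].
  by move: z {q r} (F 0) => [a b] [c e]; rewrite [RHS]normc_pair.
rewrite qE /mod_dev -normc_modulus -/z -/r.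
have n0 (x : R[i]) : (0 <= Normc.normc x) by case: x => a b; exact: sqrtr_ge0.
have t1 : (Normc.normc (z - l) <= q + `|Normc.normc (F 0) - 1|).
  rewrite -hl /q; have -> : (z - l = (z - F 0) + (F 0 - l)) by ring.
  exact: le_normcD.
have t2 : (Normc.normc (F 0) <= r + q).
  have -> : (F 0 = z + (F 0 - z)) by ring.
  by rewrite /q -(normcN (z - _)) opprB; exact: le_normcD.
have t3 : (r <= Normc.normc (F 0) + q).
  have -> : r = Normc.normc (F 0 + (z - F 0)) by rewrite /r; congr (Normc.normc _); ring.
  exact: le_normcD.
have t4 : (`|Normc.normc (F 0) - 1| <= `|r - 1| + q).
  have := ler_norm (r - 1); have := ler_norm (- (r - 1)); rewrite normrN.
  by rewrite ler_norml => ? ?; apply/andP; split; lra.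
have q0 : (0 <= q) by exact: n0.
have : (Normc.normc (z - l) <= 2 * q + `|r - 1|) by lra.
move=> /(lerXn2r 2 _ _); rewrite !nnegrE n0 addr_ge0 ?mulr_ge0// => /(_ isT isT).
move=> /le_trans; apply; rewrite -(real_normK (num_real (r - 1))).
have := sqr_ge0 (2 * q - `|r - 1|); rewrite !expr2; lra.
Qed.
End fock_distance.

Theorem theorem1p3 (R : realType) :
  exists M : R, 0 < M /\
    forall F : R[i] -> R[i], fock_space F ->
      (ereal_inf [set fock_norm (fun z => (F z - lambda)%R)
                 | lambda in [set l : R[i] | `|l|%R = 1%R]]
       <= M%:E * fock_norm (fun z => (`|F z| - 1)%R))%E.
Proof.
have [d d01 dsmall] : exists2 d : R, 0 < d <= 1 & 820 * d <= 4^-1.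
  by exists (4^-1 / 820); [apply/andP; split|]; lra.
have c0 : (0 : R) < 32 * 32 by rewrite mulr_gt0.
have [B B0 Bgain] := expR_decay c0.
rewrite -mulrA in Bgain.
pose A2 : R := 128 * B.
pose C : R := 2 * (7 + 8 * (4 / d ^+ 2)).
pose K : R := 2 * (C * expR (128 * (A2 + 1) ^+ 2) + 32 * C * (1152 * expR (33 * B))).
have d0 : 0 < d by case/andP: d01.
have C0 : 0 < C.
  by apply: mulr_gt0 => //; apply: addr_gt0 => //; apply: mulr_gt0 => //;
    apply: divr_gt0 => //; exact: exprn_gt0.
have K0 : 0 < K.
  apply: mulr_gt0; first by rewrite ltr0n.
  apply: addr_gt0; first by apply: mulr_gt0; [exact: C0|exact: expR_gt0].
  apply: mulr_gt0; first by apply: mulr_gt0; [rewrite ltr0n|exact: C0].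
  by apply: mulr_gt0; [rewrite ltr0n|exact: expR_gt0].
have bound := fun U V (hol : forall p, holo2 U V p) =>
  global_bound hol d01 dsmall B0 (lexx A2) Bgain.
rewrite -/C -/K in bound.
clearbody K; clear C C0.
(* [8] and [2] come from [fock_pointwise], [K] from [global_bound]; the square root passes from
   squared norms to norms. *)
exists (Num.sqrt (8 * K + 2)); split; first by rewrite sqrtr_gt0; lra.
move=> F [entF finF].
pose U := re_part F; pose V := im_part F.
have hol p : holo2 U V p by exact: derivable_holo2.
have mh : measurable_fun setT (osc2 U V (0, 0) : measurableTypeR R * measurableTypeR R -> R).
  by apply: cont2_measurable => p; exact: cont2_osc2.
have mdev : measurable_fun setT (mod_dev U V : measurableTypeR R * measurableTypeR R -> R).
  by apply: cont2_measurable => p; exact: cont2_mod_dev.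
pose g8 p := (8 * (osc2 U V (0, 0) p * gweight p))%:E.
pose g2 p := (2 * (mod_dev U V p * gweight p))%:E.
have mg8 : measurable_fun setT (g8 : measurableTypeR R * measurableTypeR R -> \bar R).
  apply/measurable_EFinP; apply: measurable_funM => //; apply: measurable_funM => //.
  exact: measurable_gweight.
have mg2 : measurable_fun setT (g2 : measurableTypeR R * measurableTypeR R -> \bar R).
  apply/measurable_EFinP; apply: measurable_funM => //; apply: measurable_funM => //.
  exact: measurable_gweight.
have osc0 p : 0 <= osc2 U V (0, 0) p by exact: osc2_ge0.
have dev0 p : 0 <= mod_dev U V p by exact: mod_dev_ge0.
have g80 p : (0 <= g8 p)%E by rewrite lee_fin mulr_ge0// mulr_ge0 ?gweight_ge0.
have g20 p : (0 <= g2 p)%E by rewrite lee_fin mulr_ge0// mulr_ge0 ?gweight_ge0.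
have mnorm : measurable_fun setT
    ((fun p => U p ^+ 2 + V p ^+ 2) : measurableTypeR R * measurableTypeR R -> R).
  apply: cont2_measurable => p; have [a [b [/diff2_cont2 cU /diff2_cont2 cV]]] := hol p.
  by apply: cont2D; apply: cont2M.
have norm_sqr p : Normc.normc (F (p.1 +i* p.2)) ^+ 2 = U p ^+ 2 + V p ^+ 2.
  by rewrite normc_modulus sqr_sqrtr// addr_ge0 ?sqr_ge0.
set X := (\int[lebesgue_measure \x lebesgue_measure]_p
  (osc2 U V (0, 0) p * gweight p)%:E)%E.
set Y := (\int[lebesgue_measure \x lebesgue_measure]_p
  (mod_dev U V p * gweight p)%:E)%E.
have Y0 : (0 <= Y)%E.
  by apply: integral_ge0 => p _; rewrite lee_fin mulr_ge0 ?gweight_ge0.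
pose n0 : R := U (0, 0) ^+ 2 + V (0, 0) ^+ 2.
have n00 : 0 <= n0 by rewrite addr_ge0 ?sqr_ge0.
(* Finiteness required for the absorption: [|F - F 0|^2 <= 2 * |F|^2 + 2 * |F 0|^2], and the
   Gaussian weight is integrable. *)
have Xfin : (X < +oo)%E.
  pose f1 p := ((U p ^+ 2 + V p ^+ 2) * gweight p)%:E.
  pose f2 (p : R * R) := (gweight p)%:E.
  have mf1 : measurable_fun setT (f1 : measurableTypeR R * measurableTypeR R -> \bar R).
    by apply/measurable_EFinP; apply: measurable_funM => //; exact: measurable_gweight.
  have mf2 : measurable_fun setT (f2 : measurableTypeR R * measurableTypeR R -> \bar R).
    by apply/measurable_EFinP; exact: measurable_gweight.
  have f10 p : (0 <= f1 p)%E.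
    by rewrite lee_fin mulr_ge0 ?gweight_ge0// addr_ge0 ?sqr_ge0.
  have f20 p : (0 <= f2 p)%E by rewrite lee_fin gweight_ge0.
  have I1 : (\int[lebesgue_measure \x lebesgue_measure]_p f1 p < +oo)%E.
    have := fock_integral_finite finF; congr (_ < _)%E.
    by apply: eq_integral => p _; rewrite norm_sqr.
  apply: le_lt_trans (_ : \int[lebesgue_measure \x lebesgue_measure]_p
      (2%:E * f1 p + (2 * n0)%:E * f2 p) < +oo)%E.
    apply: ge0_le_integral => //.
    - by move=> p _; rewrite lee_fin mulr_ge0 ?gweight_ge0.
    - by apply/measurable_EFinP; apply: measurable_funM => //; exact: measurable_gweight.
    - by apply: emeasurable_funD; apply: emeasurable_funM => //; exact: measurable_cst.
    - move=> p _; rewrite /f1 /f2 -!EFinM -EFinD lee_fin mulrA -mulrDl.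
      apply: ler_wpM2r; first exact: gweight_ge0.
      rewrite /osc2 /n0; have := sqr_ge0 (U p + U (0, 0)); have := sqr_ge0 (V p + V (0, 0)).
      by rewrite !expr2; lra.
  rewrite ge0_integralD//; last 4 first.
  - by move=> p _; rewrite mule_ge0.
  - by apply: emeasurable_funM => //; exact: measurable_cst.
  - by move=> p _; rewrite mule_ge0// lee_fin mulr_ge0.
  - by apply: emeasurable_funM => //; exact: measurable_cst.
  have f1p p : [set: measurableTypeR R * measurableTypeR R] p -> (0 <= f1 p)%E by [].
  have n02 : (0 <= 2 * n0) by rewrite mulr_ge0.
  rewrite !ge0_integralZl//.
  by apply: lte_add_pinfty; apply: lte_mul_pinfty => //; exact: gweight_integrable.
have XY := bound U V hol Xfin; rewrite -/X -/Y in XY.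
have [l l1 hl] := nearest_unit (F 0).
(* The infimum is bounded by its value at the single [l] nearest to [F 0]. *)
apply: le_trans (ereal_inf_lbound _) _; first by exists l.
rewrite !fock_normE.
have -> : (\int[lebesgue_measure \x lebesgue_measure]_p
    (Normc.normc (`|F (p.1 +i* p.2)| - 1) ^+ 2 * gweight p)%:E = Y)%E.
  apply: eq_integral => p _; congr (_ * _)%:E; rewrite /mod_dev -normc_modulus.
  by case: (F _) => a b; rewrite normc_def /= subr0 expr0n addr0 sqr_sqrtr ?sqr_ge0.
have KY : (0 <= (8 * K + 2)%:E * Y)%E by rewrite mule_ge0// lee_fin; lra.
have pi0 : (0 <= (pi^-1 : R)%:E)%E by rewrite lee_fin invr_ge0 pi_ge0.
apply: le_trans (_ : sqrte ((pi^-1)%:E * ((8 * K + 2)%:E * Y)) <= _)%E.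
  rewrite lee_sqrt; last by rewrite mule_ge0.
  apply: lee_wpmul2l => //.
  apply: le_trans (_ : \int[lebesgue_measure \x lebesgue_measure]_p (g8 p + g2 p) <= _)%E.
    apply: ge0_le_integral => //.
    - by move=> p _; rewrite lee_fin mulr_ge0 ?gweight_ge0// sqr_ge0.
    - apply/measurable_EFinP; apply: measurable_funM; last exact: measurable_gweight.
      rewrite [X in measurable_fun _ X](_ : _ = fun p =>
        (U p - complex.Re l) ^+ 2 + (V p - complex.Im l) ^+ 2); last first.
        apply/funext => p; rewrite /U /V /re_part /im_part.
        by case: (F _) => a b; case: (l) => c e; rewrite [LHS]normc_pair.
      apply: cont2_measurable => p.
      have [a [b [/diff2_cont2 cU /diff2_cont2 cV]]] := hol p.
      by apply: cont2D; apply: cont2M; apply: cont2D => //; exact: cont2_cst.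
    - exact: emeasurable_funD.
    - move=> p _; rewrite /g8 /g2 -EFinD lee_fin (mulrA 8) (mulrA 2) -mulrDl.
      by apply: ler_wpM2r; [exact: gweight_ge0|exact: fock_pointwise].
  rewrite ge0_integralD//.
  have p1 p : [set: measurableTypeR R * measurableTypeR R] p ->
    (0 <= (osc2 U V (0, 0) p * gweight p)%:E)%E by rewrite lee_fin mulr_ge0 ?gweight_ge0.
  have p2 p : [set: measurableTypeR R * measurableTypeR R] p ->
    (0 <= (mod_dev U V p * gweight p)%:E)%E by rewrite lee_fin mulr_ge0 ?gweight_ge0.
  rewrite /g8 /g2; under eq_integral do rewrite EFinM.
  under [X in (_ + X)%E]eq_integral do rewrite EFinM.
  rewrite !ge0_integralZl//; last 2 first.
  - by apply/measurable_EFinP; apply: measurable_funM => //; exact: measurable_gweight.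
  - by apply/measurable_EFinP; apply: measurable_funM => //; exact: measurable_gweight.
  have -> : ((8 * K + 2)%:E * Y = 8%:E * (K%:E * Y) + 2%:E * Y)%E.
    rewrite muleA -EFinM -ge0_muleDl//.
    by rewrite lee_fin mulr_ge0// ltW.
  by apply: leeD => //; apply: lee_wpmul2l.
rewrite muleCA sqrteM; last by rewrite lee_fin; lra.
by [].
Qed.
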